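(* Let $0<\vartheta_1,\dots,\vartheta_n\le\pi/2$ with $\sum_{i=1}^n(\pi-\vartheta_i)>2\pi$, and let $\mathfrak P(\vartheta_1,\dots,\vartheta_n)$ be the space of hyperbolic $n$-gons with those ordered angles. (a) The perimeter has a unique minimum in $\mathfrak P(\vartheta_1,\dots,\vartheta_n)$. In addition, this is the only polygon in $\mathfrak P(\vartheta_1,\dots,\vartheta_n)$ that has an inscribed circle tangent to all of its edges. (b) For $\mathcal W=\{w_1,\dots,w_n\}$ with $w_i>0$, the $\mathcal W$-perimeter has a unique minimum in $\mathfrak P(\vartheta_1,\dots,\vartheta_n)$. In addition, this is the only polygon in $\mathfrak P(\vartheta_1,\dots,\vartheta_n)$ that has a point $p$ in its interior such that $\frac1{w_i}\sinh(d(e_i,p))$ is independent of the edge $e_i$ of the polygon.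
   Context: Polygons are convex polygons in $\mathbf H^2$ with labelled edges $e_1,\dots,e_n$ in cyclic order, considered up to isometry preserving labels. The $\mathcal W$-perimeter of a polygon with edges $e_1,\dots,e_n$ is $w_1|e_1|+\cdots+w_n|e_n|$, where $|e_i|$ is the length of $e_i$; the perimeter is the case of all weights equal to $1$. $d$ is hyperbolic distance. *)

(* Defs.v *)
From HB Require Import structures.
From mathcomp Require Import all_boot all_order all_algebra.
From mathcomp Require Import all_classical all_reals all_analysis.
Set Implicit Arguments.
Unset Strict Implicit.
Unset Printing Implicit Defensive.
Import Order.TTheory GRing.Theory Num.Theory.

Local Open Scope classical_set_scope.
Local Open Scope ring_scope.

Definition sinh (R : realType) (x : R) : R := (expR x - expR (- x)) / 2.

(* Inverse of cosh on [1, +oo[. *)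
Definition arcosh (R : realType) (x : R) : R := ln (x + Num.sqrt (x ^+ 2 - 1)).

(* The Lorentz form of signature (2,1), coordinate 0 being the timelike one. *)
Definition mdot (R : realType) (u v : 'rV[R]_3) : R :=
  - (u 0 0 * v 0 0) + u 0 1 * v 0 1 + u 0 2 * v 0 2.

(* Hyperboloid model: the upper sheet of mdot u u = -1. *)
Record H2 (R : realType) := MkH2 {
  hpt :> 'rV[R]_3;
  hptP : (mdot hpt hpt == - 1) && (0 < hpt 0 0)
}.
HB.instance Definition _ (R : realType) := [isSub for @hpt R].
HB.instance Definition _ (R : realType) := [Choice of H2 R by <:].

Section HyperbolicPlane.
Variable R : realType.
Implicit Types (x y z p : H2 R) (A L : set (H2 R)).

Definition hdist x y : R := arcosh (- mdot x y).

Definition hdist_set A p : R := inf [set hdist p q | q in A].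

Definition hball p (r : R) : set (H2 R) := [set q | hdist p q < r].

Definition hcircle p (r : R) : set (H2 R) := [set q | hdist p q = r].

Definition hinterior A : set (H2 R) :=
  [set p | exists2 r : R, 0 < r & hball p r `<=` A].

Definition hisometry (f : H2 R -> H2 R) : Prop :=
  bijective f /\ forall x y, hdist (f x) (f y) = hdist x y.

(* In the hyperboloid model, geodesics are the intersections of the sheet with
   linear planes, and the arc from x to y is cut out by the cone on x and y. *)
Definition hline x y : set (H2 R) :=
  [set z | exists a b : R, hpt z = a *: hpt x + b *: hpt y].

Definition hsegment x y : set (H2 R) :=
  [set z | exists a b : R,
     [/\ 0 <= a, 0 <= b & hpt z = a *: hpt x + b *: hpt y]].

(* p and q lie in the same open half-plane bounded by L; in particular neither
   lies on L, since the endpoints belong to the segment. *)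
Definition same_side L p q : Prop := hsegment p q `&` L = set0.

(* Tangent vector at x pointing towards y: the component of y that is
   mdot-orthogonal to x (recall mdot x x = -1). *)
Definition hdir x y : 'rV[R]_3 := hpt y + mdot x y *: hpt x.

(* Angle at x between the geodesic rays towards y and z; the tangent space at
   x is positive definite for mdot. *)
Definition hangle x y z : R :=
  let u := hdir x y in let v := hdir x z in
  acos (mdot u v / (Num.sqrt (mdot u u) * Num.sqrt (mdot v v))).

End HyperbolicPlane.

Section Polygons.
Variables (R : realType) (n : nat).

(* A polygon is given by its vertices in cyclic order. The edge labelled i
   joins vertex i to vertex i+1 (mod n), and the angle labelled i is the one
   at vertex i, between the edges i-1 and i. *)
Notation vertices := ('I_n -> H2 R).
Implicit Types (P Q : vertices) (i j k : 'I_n).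

Definition edge P i : set (H2 R) := hsegment (P i) (P (ordS i)).

Definition edge_line P i : set (H2 R) := hline (P i) (P (ordS i)).

Definition edge_length P i : R := hdist (P i) (P (ordS i)).

Definition off_edge i j : bool := (j != i) && (j != ordS i).

(* The strict condition rules out flat vertices, coincident vertices and
   polygons winding several times around. *)
Definition convex_polygon P : Prop :=
  [/\ (3 <= n)%N,
      forall i, P i <> P (ordS i)
    & forall i j k, off_edge i j -> off_edge i k ->
        same_side (edge_line P i) (P j) (P k)].

(* The closed region bounded by the polygon, as an intersection of closed
   half-planes. *)
Definition region P : set (H2 R) :=
  [set z | forall i, edge_line P i z \/
     forall j, off_edge i j -> same_side (edge_line P i) z (P j)].

Definition angle P i : R := hangle (P i) (P (ord_pred i)) (P (ordS i)).

Definition polygons_with_angles (theta : 'I_n -> R) : set vertices :=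
  [set P | convex_polygon P /\ forall i, angle P i = theta i].

(* Isometries may reverse orientation; correspondingly, convex_polygon does
   not prescribe the sense in which the boundary is traversed. *)
Definition congruent P Q : Prop :=
  exists f : H2 R -> H2 R, hisometry f /\ forall i, f (P i) = Q i.

Definition weighted_perimeter (w : 'I_n -> R) P : R :=
  \sum_(i < n) w i * edge_length P i.

Definition perimeter P : R := weighted_perimeter (fun=> 1) P.

Definition minimizers (F : vertices -> R) (S : set vertices) : set vertices :=
  [set P | S P /\ forall Q, S Q -> F P <= F Q].

Definition only_up_to_congruence (S : set vertices) P : Prop :=
  S P /\ forall Q, S Q -> congruent P Q.

(* A circle is tangent to an edge when it meets the line carrying that edge in
   exactly one point, and this point lies on the edge. *)
Definition tangent_to_edge (c : H2 R) (r : R) P i : Prop :=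
  exists q, edge P i q /\ hcircle c r `&` edge_line P i = [set q].

Definition has_inscribed_circle P : Prop :=
  exists c (r : R), [/\ 0 < r, hcircle c r `<=` region P
    & forall i, tangent_to_edge c r P i].

Definition has_weighted_center (w : 'I_n -> R) P : Prop :=
  exists2 p, hinterior (region P) p &
    forall i j, (w i)^-1 * sinh (hdist_set (edge P i) p) =
                (w j)^-1 * sinh (hdist_set (edge P j) p).

End Polygons.

(* Main.v *)
Require Import Defs.
From mathcomp Require Import all_boot all_order all_algebra.
From mathcomp Require Import all_classical all_reals all_analysis.
From mathcomp Require Import ring lra zify.
Import Order.TTheory GRing.Theory Num.Theory.
Import numFieldNormedType.Exports.
Local Open Scope classical_set_scope.
Local Open Scope ring_scope.

(* View a polygon from an interior point q and let s_i be sinh of the distance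
   from q to edge i.  The edge lengths l_i and the angles at q between the
   perpendiculars to consecutive edges are explicit functions of s, and those
   angles add up to 2 pi.  Conversely every positive s with total angle 2 pi
   comes from a polygon: as the prescribed angles are at most pi / 2, the feet of
   the perpendiculars lie inside the edges.  The point q is a weighted centre iff
   s is proportional to w; the total angle strictly decreases when s is scaled
   up, so exactly one multiple t w is admissible, and lengths and angles determine
   a polygon up to congruence.

   For minimality, join the data s of an arbitrary polygon to t w by a segment,
   rescaled so as to keep the total angle 2 pi.  The matrix A of the derivatives
   of l with respect to s is symmetric and the gradient of the total angle is
   - A s.  After division by the cosh of the distances, A becomes the area form
   of the Euclidean polygons with edge normals in the same directions, so that
   Minkowski's inequality gives u^T A u <= 0 whenever u^T A s = 0.  With u the
   velocity of the path, the derivative of sum_i w_i l_i is a positive multiple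
   of u^T A u; if it vanishes identically, then l is constant. *)

Set Implicit Arguments.
Unset Strict Implicit.
Unset Printing Implicit Defensive.

(** * Hyperbolic functions *)

Section HyperbolicFunctions.
Variable R : realType.
Implicit Types x y z : R.

(** The two hypotheses on the angles play different roles. At s = 0 each turn is the Euclidean
    exterior angle pi - theta_i, so the condition on the sum says that the total angle starts above
    2 pi; for large s it falls below 2 pi, and so every positive w has an admissible multiple. The
    bound pi / 2 makes each cos theta_i nonnegative. This keeps the feet of the perpendiculars
    inside the edges, makes all partial derivatives of the total angle negative, and makes s^T A s
    positive, as Minkowski's inequality requires. The obstacle in passing between polygons and data
    is global. Step by step, the frames at the vertices determine the total angle only modulo 2 pi,
    so convexity has to exclude a second revolution; conversely, for data of total angle 2 pi, every
    vertex has to be shown to lie on the inner side of every edge. *)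

Definition cosh x : R := (expR x + expR (- x)) / 2.

Definition asinh x : R := ln (x + Num.sqrt (1 + x ^+ 2)).

Lemma sqrtr_eqP (x y : R) : 0 <= y -> y ^+ 2 = x -> Num.sqrt x = y.
Proof. by move=> y0 <-; rewrite sqrtr_sqr ger0_norm. Qed.

Lemma cosh2_sinh2 x : cosh x ^+ 2 - sinh x ^+ 2 = 1.
Proof.
have : expR x * expR (- x) = 1 by rewrite -expRD subrr expR0.
by rewrite /cosh /sinh; move: (expR x) (expR _) => a b ab; field: ab.
Qed.

Lemma coshD x y : cosh (x + y) = cosh x * cosh y + sinh x * sinh y.
Proof. by rewrite /cosh /sinh opprD !expRD; field. Qed.

Lemma sinhD x y : sinh (x + y) = sinh x * cosh y + cosh x * sinh y.
Proof. by rewrite /cosh /sinh opprD !expRD; field. Qed.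

Lemma coshN x : cosh (- x) = cosh x.
Proof. by rewrite /cosh opprK addrC. Qed.

Lemma sinhN x : sinh (- x) = - sinh x.
Proof. by rewrite /sinh opprK -mulNr opprB. Qed.

Lemma cosh0 : cosh 0 = 1.
Proof. by rewrite /cosh oppr0 expR0; field. Qed.

Lemma sinh0 : sinh 0 = 0 :> R.
Proof. by rewrite /sinh oppr0 subrr mul0r. Qed.

Lemma cosh_gt0 x : 0 < cosh x.
Proof. by rewrite divr_gt0// addr_gt0// expR_gt0. Qed.

Lemma cosh_ge1 x : 1 <= cosh x.
Proof.
rewrite -(@ler_pXn2r _ 2)// ?nnegrE ?(ltW (cosh_gt0 _))// expr1n.
by have := cosh2_sinh2 x; have := sqr_ge0 (sinh x); lra.
Qed.

Lemma sinh_gt0 x : 0 < x -> 0 < sinh x.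
Proof. by move=> x0; rewrite divr_gt0// subr_gt0 ltr_expR; lra. Qed.

Lemma sinh_ge0 x : 0 <= x -> 0 <= sinh x.
Proof. by rewrite le0r => /orP[/eqP->|/sinh_gt0/ltW//]; rewrite sinh0. Qed.

Lemma coshE x : cosh x = Num.sqrt (1 + sinh x ^+ 2).
Proof.
by apply/esym/sqrtr_eqP; [exact/ltW/cosh_gt0|have := cosh2_sinh2 x; lra].
Qed.

Lemma sinh_asinh x : sinh (asinh x) = x.
Proof.
have h : 0 < 1 + x ^+ 2 by have := sqr_ge0 x; lra.
have h2 := sqr_sqrtr (ltW h); have h3 := sqrtr_ge0 (1 + x ^+ 2).
have p : 0 < x + Num.sqrt (1 + x ^+ 2).
  have : `|x| < Num.sqrt (1 + x ^+ 2) by rewrite -sqrtr_sqr ltr_sqrt//; lra.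
  by rewrite ltr_norml => /andP[]; lra.
rewrite /asinh /sinh expRN lnK//; move: p h2; set r := Num.sqrt _ => p h2.
by field: h2; rewrite lt0r_neq0.
Qed.

Lemma asinhK x : asinh (sinh x) = x.
Proof.
rewrite /asinh -coshE /cosh /sinh.
by rewrite (_ : _ + _ = expR x) ?expRK//; field.
Qed.

Lemma cosh_asinh x : cosh (asinh x) = Num.sqrt (1 + x ^+ 2).
Proof. by rewrite coshE sinh_asinh. Qed.

Lemma sinh_inj : injective (@sinh R).
Proof. by move=> x y e; rewrite -[x]asinhK e asinhK. Qed.

Lemma ltr_sinh : {mono @sinh R : x y / x < y}.
Proof.
move=> x y; apply: (@leW_mono _ _ _ _ (@sinh R)).
apply: le_mono => a b ab.
by rewrite /sinh ltr_pM2r ?invr_gt0// ltrB// ltr_expR//; lra.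
Qed.

Lemma asinh_gt0 x : 0 < x -> 0 < asinh x.
Proof. by move=> x0; rewrite -ltr_sinh sinh_asinh sinh0. Qed.

Lemma arcosh_cosh x : 0 <= x -> arcosh (cosh x) = x.
Proof.
move=> x0; rewrite /arcosh (@sqrtr_eqP _ (sinh x)) ?sinh_ge0//.
  by rewrite /cosh /sinh (_ : _ + _ = expR x) ?expRK//; field.
by have := cosh2_sinh2 x; lra.
Qed.

Lemma cosh_arcosh x : 1 <= x -> cosh (arcosh x) = x.
Proof.
move=> x1.
have h : 0 <= x ^+ 2 - 1 by rewrite subr_ge0 exprn_ege1.
have h2 := sqr_sqrtr h; have h3 := sqrtr_ge0 (x ^+ 2 - 1).
have p : 0 < x + Num.sqrt (x ^+ 2 - 1) by lra.
rewrite /arcosh /cosh expRN lnK//; move: p h2; set r := Num.sqrt _ => p h2.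
by field: h2; rewrite lt0r_neq0.
Qed.

Lemma arcosh_ge0 x : 1 <= x -> 0 <= arcosh x.
Proof.
move=> x1; apply: ln_ge0.
by have := sqrtr_ge0 (x ^+ 2 - 1); lra.
Qed.

Lemma ltr_cosh : {in Num.nneg &, {mono cosh : x y / x < y}}.
Proof.
move=> x y; rewrite !nnegrE => x0 y0.
rewrite -(@ltr_pXn2r _ 2)// ?nnegrE ?(ltW (cosh_gt0 _))//.
rewrite (_ : cosh x ^+ 2 = 1 + sinh x ^+ 2); last by have := cosh2_sinh2 x; lra.
rewrite (_ : cosh y ^+ 2 = 1 + sinh y ^+ 2); last by have := cosh2_sinh2 y; lra.
by rewrite ltrD2l ltr_pXn2r ?nnegrE ?sinh_ge0// ltr_sinh.
Qed.

Lemma ler_arcosh x y : 1 <= x -> x <= y -> arcosh x <= arcosh y.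
Proof.
move=> x1 xy; have y1 := le_trans x1 xy.
by rewrite leNgt -ltr_cosh ?nnegrE ?arcosh_ge0// !cosh_arcosh// ltNge xy.
Qed.

Lemma sinh_arcosh x : 1 <= x -> sinh (arcosh x) = Num.sqrt (x ^+ 2 - 1).
Proof.
move=> x1; apply/esym/sqrtr_eqP; first by rewrite sinh_ge0 ?arcosh_ge0.
by have := cosh2_sinh2 (arcosh x); rewrite cosh_arcosh//; lra.
Qed.

Lemma is_derive_asinh x : is_derive x 1 asinh (Num.sqrt (1 + x ^+ 2))^-1.
Proof.
have h : 0 < 1 + x ^+ 2 by have := sqr_ge0 x; lra.
have h2 := sqr_sqrtr (ltW h).
have r0 : 0 < Num.sqrt (1 + x ^+ 2) by rewrite sqrtr_gt0.
have p : 0 < x + Num.sqrt (1 + x ^+ 2).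
  have : `|x| < Num.sqrt (1 + x ^+ 2) by rewrite -sqrtr_sqr ltr_sqrt//; lra.
  by rewrite ltr_norml => /andP[]; lra.
have d1 : is_derive x 1 (fun y : R => 1 + y ^+ 2) (2 * x).
  by apply: is_derive_eq; rewrite add0r /GRing.scale /=; ring.
have d2 := @is_derive1_comp _ Num.sqrt _ x _ _ (is_derive1_sqrt h) d1.
have d3 := @is_derive1_comp _ (@ln R) _ x _ _ (is_derive1_ln p)
  (is_deriveD (is_derive_id x 1) d2).
apply: (is_derive_eq d3); field.
by rewrite !lt0r_neq0.
Qed.

End HyperbolicFunctions.

(** * The hyperboloid *)

Section Minkowski.
Variable R : realType.
Implicit Types (u v w : 'rV[R]_3) (x y z p : H2 R) (a b : R).

Definition vec3 a b c : 'rV[R]_3 := \row_j [:: a; b; c]`_j.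

Lemma vec3E0 a b c : vec3 a b c 0 0 = a. Proof. by rewrite mxE. Qed.
Lemma vec3E1 a b c : vec3 a b c 0 1 = b. Proof. by rewrite mxE. Qed.
Lemma vec3E2 a b c : vec3 a b c 0 2 = c. Proof. by rewrite mxE. Qed.

Lemma vec3_ext u v : u 0 0 = v 0 0 -> u 0 1 = v 0 1 -> u 0 2 = v 0 2 -> u = v.
Proof.
move=> h0 h1 h2; apply/rowP => -[[|[|[|//]]] hi].
- by rewrite (_ : Ordinal hi = 0)//; apply/val_inj.
- by rewrite (_ : Ordinal hi = 1)//; apply/val_inj.
- by rewrite (_ : Ordinal hi = 2)//; apply/val_inj.
Qed.

Lemma mdotC u v : mdot u v = mdot v u.
Proof. by rewrite /mdot; ring. Qed.

Lemma mdotDl u v w : mdot (u + v) w = mdot u w + mdot v w.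
Proof. by rewrite /mdot !mxE; ring. Qed.

Lemma mdotZl a u v : mdot (a *: u) v = a * mdot u v.
Proof. by rewrite /mdot !mxE; ring. Qed.

Lemma mdotDr u v w : mdot w (u + v) = mdot w u + mdot w v.
Proof. by rewrite mdotC mdotDl !(mdotC w). Qed.

Lemma mdotZr a u v : mdot u (a *: v) = a * mdot u v.
Proof. by rewrite mdotC mdotZl mdotC. Qed.

Lemma mdotNl u v : mdot (- u) v = - mdot u v.
Proof. by rewrite /mdot !mxE; ring. Qed.

Lemma mdotNr u v : mdot u (- v) = - mdot u v.
Proof. by rewrite mdotC mdotNl mdotC. Qed.

Definition mdotE := (mdotDl, mdotDr, mdotNl, mdotNr, mdotZl, mdotZr).

Definition mcross u v : 'rV[R]_3 :=
  vec3 (u 0 2 * v 0 1 - u 0 1 * v 0 2)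
       (u 0 2 * v 0 0 - u 0 0 * v 0 2)
       (u 0 0 * v 0 1 - u 0 1 * v 0 0).

Lemma mcross_l u v : mdot (mcross u v) u = 0.
Proof. by rewrite /mdot !mxE/=; ring. Qed.

Lemma mcross_r u v : mdot (mcross u v) v = 0.
Proof. by rewrite /mdot !mxE/=; ring. Qed.

Lemma mcross_norm u v :
  mdot (mcross u v) (mcross u v) = mdot u v ^+ 2 - mdot u u * mdot v v.
Proof. by rewrite /mdot !mxE/=; ring. Qed.

Lemma mdot_H2 x : mdot x x = - 1.
Proof. by case: x => v /= /andP[/eqP]. Qed.

Lemma H2_gt0 x : 0 < hpt x 0 0.
Proof. by case: x => v /= /andP[]. Qed.

Lemma H2_inj x y : hpt x = hpt y -> x = y.
Proof. exact: val_inj. Qed.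

(** Reversed Cauchy-Schwarz: by Lagrange's identity, [(x0 y0)^2 - (1 + x1 y1 + x2 y2)^2] is a sum of
    three squares, and [x0 y0 > 0] settles the sign. In the equality case below all three squares
    vanish. *)
Lemma mdot_H2_le x y : mdot x y <= - 1.
Proof.
have := mdot_H2 x; have := mdot_H2 y; have := H2_gt0 x; have := H2_gt0 y.
rewrite /mdot; move: (hpt x 0 0) (hpt x 0 1) (hpt x 0 2).
move: (hpt y 0 0) (hpt y 0 1) (hpt y 0 2) => b0 b1 b2 a0 a1 a2 b0p a0p hb ha.
have sqE : (a0 * b0) ^+ 2 - (1 + (a1 * b1 + a2 * b2)) ^+ 2 =
    (a1 - b1) ^+ 2 + (a2 - b2) ^+ 2 + (a1 * b2 - a2 * b1) ^+ 2.
  rewrite exprMn (_ : a0 ^+ 2 = 1 + a1 ^+ 2 + a2 ^+ 2); last by lra.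
  by rewrite (_ : b0 ^+ 2 = 1 + b1 ^+ 2 + b2 ^+ 2); [ring|lra].
have := sqr_ge0 (a1 - b1); have := sqr_ge0 (a2 - b2).
have := sqr_ge0 (a1 * b2 - a2 * b1); have ab0 := mulr_gt0 a0p b0p.
nra.
Qed.

Lemma mdot_H2_eq x y : mdot x y = - 1 -> x = y.
Proof.
move=> xy; apply/H2_inj; move: xy.
have := mdot_H2 x; have := mdot_H2 y; have := H2_gt0 x; have := H2_gt0 y.
move: (hpt x) (hpt y) => u v v0 u0 vv uu uv.
have sqE : (u 0 1 - v 0 1) ^+ 2 + (u 0 2 - v 0 2) ^+ 2
    + (u 0 1 * v 0 2 - u 0 2 * v 0 1) ^+ 2 = 0.
  transitivity ((u 0 0 * v 0 0) ^+ 2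
      - (1 + (u 0 1 * v 0 1 + u 0 2 * v 0 2)) ^+ 2).
    rewrite exprMn (_ : u 0 0 ^+ 2 = 1 + u 0 1 ^+ 2 + u 0 2 ^+ 2).
      rewrite (_ : v 0 0 ^+ 2 = 1 + v 0 1 ^+ 2 + v 0 2 ^+ 2); first by ring.
      by move: vv; rewrite /mdot; lra.
    by move: uu; rewrite /mdot; lra.
  by rewrite (_ : u 0 0 * v 0 0 = 1 + (u 0 1 * v 0 1 + u 0 2 * v 0 2));
    [ring|move: uv; rewrite /mdot; lra].
have e1 : (u 0 1 - v 0 1) ^+ 2 = 0.
  by apply/eqP; rewrite eq_le sqr_ge0 andbT; move: sqE;
  have := sqr_ge0 (u 0 2 - v 0 2);
  have := sqr_ge0 (u 0 1 * v 0 2 - u 0 2 * v 0 1); lra.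
have e2 : (u 0 2 - v 0 2) ^+ 2 = 0.
  by apply/eqP; rewrite eq_le sqr_ge0 andbT; move: sqE;
  have := sqr_ge0 (u 0 1 * v 0 2 - u 0 2 * v 0 1); lra.
have h1 : u 0 1 = v 0 1 by apply/eqP; rewrite -subr_eq0 -sqrf_eq0 e1.
have h2 : u 0 2 = v 0 2 by apply/eqP; rewrite -subr_eq0 -sqrf_eq0 e2.
apply: vec3_ext => //.
by apply/eqP; rewrite -(@eqrXn2 _ 2) ?ltW//; apply/eqP;
  move: uu vv; rewrite /mdot h1 h2; lra.
Qed.

(** If v were on the lower sheet, - v would be a point of [H2], and [mdot_H2_le] would give
    [mdot v x >= 1]. *)
Lemma H2_sheet v x : mdot v v = - 1 -> mdot v x < 0 ->
  (mdot v v == - 1) && (0 < v 0 0).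
Proof.
move=> vv vx; rewrite vv eqxx /= ltNge; apply/negP => v0.
have wP : (mdot (- v) (- v) == - 1) && (0 < (- v) 0 0).
  rewrite mdotNl mdotNr opprK vv eqxx mxE oppr_gt0 lt_neqAle v0 andbT.
  apply/eqP => v00; move: vv; rewrite /mdot v00.
  by have := sqr_ge0 (v 0 1); have := sqr_ge0 (v 0 2); lra.
by have := mdot_H2_le (MkH2 wP) x; rewrite /= mdotNl; lra.
Qed.

Lemma cosh_hdist x y : cosh (hdist x y) = - mdot x y.
Proof. by rewrite /hdist cosh_arcosh//; have := mdot_H2_le x y; lra. Qed.

Lemma hdist_ge0 x y : 0 <= hdist x y.
Proof. by rewrite /hdist arcosh_ge0//; have := mdot_H2_le x y; lra. Qed.

Lemma hdist_cosh x y t : 0 <= t -> - mdot x y = cosh t -> hdist x y = t.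
Proof. by move=> t0 e; rewrite /hdist e arcosh_cosh. Qed.

Lemma hdist_gt0 x y : x <> y -> 0 < hdist x y.
Proof.
move=> xy; rewrite lt0r hdist_ge0 andbT; apply/eqP => d0; apply: xy.
by apply: mdot_H2_eq; rewrite -[LHS]opprK -cosh_hdist d0 cosh0.
Qed.

Definition orthoframe p u v : Prop :=
  [/\ mdot u u = 1, mdot v v = 1, mdot p u = 0, mdot p v = 0 & mdot u v = 0].

(** Let M have rows p, u, v, and let M' be its Lorentz adjoint, the transpose with signs.
    Orthonormality says M M' = 1; a one-sided inverse of a square matrix is two-sided, and M' M = 1
    is the expansion. *)
Lemma orthoframe_coord p u v w : orthoframe p u v ->
  w = - mdot w p *: hpt p + mdot w u *: u + mdot w v *: v.
Proof.
case=> uu vv pu pv uv.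
pose M : 'M[R]_3 := \matrix_(i, j) [:: hpt p 0 j; u 0 j; v 0 j]`_i.
pose M' : 'M[R]_3 := \matrix_(i, j)
  [:: [:: hpt p 0 0; u 0 0 * -1; v 0 0 * -1]`_j;
      [:: hpt p 0 1 * -1; u 0 1; v 0 1]`_j;
      [:: hpt p 0 2 * -1; u 0 2; v 0 2]`_j]`_i.
have sum3 (F : 'I_3 -> R) : \sum_i F i = F 0 + F 1 + F 2.
  rewrite !big_ord_recr big_ord0 /= add0r.
  by congr (F _ + F _ + F _); apply/val_inj.
have MM : M *m M' = 1%:M.
  have pp := mdot_H2 p; rewrite /mdot in pp uu vv pu pv uv.
  apply/matrixP => i j; rewrite !mxE sum3 !mxE /=.
  by case: i => [[|[|[|//]]] hi]; case: j => [[|[|[|//]]] hj];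
    rewrite /= ?mulr1n ?mulr0n; lra.
rewrite -[LHS]mulmx1 -(mulmx1C MM) mulmxA.
by apply: vec3_ext; rewrite !mxE sum3 !mxE !sum3 !mxE /= /mdot; ring.
Qed.

Lemma orthoframe_mdot p u v w w' : orthoframe p u v ->
  mdot w w' = - (mdot w p * mdot w' p) + mdot w u * mdot w' u
              + mdot w v * mdot w' v.
Proof.
move=> fr; rewrite {1}(orthoframe_coord w fr) !mdotE !(mdotC _ w').
ring.
Qed.

Definition frame_map p u v p' u' v' w : 'rV[R]_3 :=
  - mdot w p *: hpt p' + mdot w u *: u' + mdot w v *: v'.

Lemma frame_mapK p u v p' u' v' : orthoframe p u v -> orthoframe p' u' v' ->
  cancel (frame_map p u v p' u' v') (frame_map p' u' v' p u v).
Proof.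
move=> fr [uu vv pu pv uv] w; rewrite [RHS](orthoframe_coord w fr) /frame_map.
rewrite !mdotE mdot_H2 uu vv (mdotC u') (mdotC v') (mdotC v') pu pv uv.
by congr (_ *: _ + _ *: _ + _ *: _); ring.
Qed.

Lemma frame_map_mdot p u v p' u' v' w w' :
  orthoframe p u v -> orthoframe p' u' v' ->
  mdot (frame_map p u v p' u' v' w) (frame_map p u v p' u' v' w') = mdot w w'.
Proof.
move=> fr [uu vv pu pv uv]; rewrite (orthoframe_mdot w w' fr) /frame_map.
rewrite !mdotE mdot_H2 uu vv (mdotC u' (hpt p')) (mdotC v' (hpt p')) (mdotC v' u').
by rewrite pu pv uv; ring.
Qed.

Lemma frame_isometry p u v p' u' v' :
  orthoframe p u v -> orthoframe p' u' v' ->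
  exists2 f : H2 R -> H2 R, hisometry f &
    forall z, hpt (f z) = frame_map p u v p' u' v' (hpt z).
Proof.
move=> fr fr'.
have H p1 u1 v1 p2 u2 v2 (f1 : orthoframe p1 u1 v1) (f2 : orthoframe p2 u2 v2)
    (z : H2 R) : (mdot (frame_map p1 u1 v1 p2 u2 v2 z)
                    (frame_map p1 u1 v1 p2 u2 v2 z) == -1) &&
                 (0 < (frame_map p1 u1 v1 p2 u2 v2 z) 0 0).
  apply: (@H2_sheet _ p2); first by rewrite frame_map_mdot// mdot_H2.
  case: f2 => _ _ pu pv _.
  rewrite /frame_map !mdotE mdot_H2 (mdotC u2) (mdotC v2) pu pv.
  by have := mdot_H2_le z p1; lra.
pose f z := MkH2 (H _ _ _ _ _ _ fr fr' z).
pose g z := MkH2 (H _ _ _ _ _ _ fr' fr z).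
exists f => //; split; last by move=> x y; rewrite /hdist /= frame_map_mdot.
by exists g => z; apply/H2_inj; rewrite /= frame_mapK.
Qed.

End Minkowski.

(** * Cyclic labels *)

Section CyclicOrdinals.
Variable n : nat.
Implicit Types i j : 'I_n.

Lemma ordSE i : (ordS i : nat) = if i.+1 == n then 0%N else i.+1.
Proof.
rewrite /=; case: eqP => [->|/eqP ne]; first by rewrite modnn.
by rewrite modn_small// ltn_neqAle ne ltn_ord.
Qed.

Lemma ordS_neq i : (2 <= n)%N -> ordS i != i.
Proof.
move=> n2; apply/eqP => /(congr1 (@nat_of_ord n)); rewrite ordSE.
by case: ifP => /eqP; have := ltn_ord i; lia.
Qed.

Lemma ordSS_neq i : (3 <= n)%N -> ordS (ordS i) != i.
Proof.
move=> n3; apply/eqP => /(congr1 (@nat_of_ord n)); rewrite !ordSE.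
by do 2 case: ifP => /eqP; have := ltn_ord i; lia.
Qed.

Lemma off_edge_SS i : (3 <= n)%N -> off_edge i (ordS (ordS i)).
Proof. by move=> n3; rewrite /off_edge ordSS_neq//= ordS_neq// ltnW. Qed.

Lemma off_edge_S i : (3 <= n)%N -> off_edge (ordS i) i.
Proof.
by move=> n3; rewrite /off_edge !(eq_sym i) ordSS_neq// ordS_neq// ltnW.
Qed.

End CyclicOrdinals.

(** * Lines, sides and unit normals *)

Section Lines.
Variable R : realType.
Implicit Types (N u v : 'rV[R]_3) (x y z p q : H2 R).

(* Locked so that the bilinearity rules of mdot do not see through it. *)
Definition htan x y : 'rV[R]_3 := locked ((sinh (hdist x y))^-1 *: hdir x y).

Lemma sinh_hdist_gt0 x y : x <> y -> 0 < sinh (hdist x y).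
Proof. by move=> /hdist_gt0/sinh_gt0. Qed.

Lemma htan_end x y : x <> y ->
  hpt y = cosh (hdist x y) *: hpt x + sinh (hdist x y) *: htan x y.
Proof.
move=> /sinh_hdist_gt0 s0; rewrite /htan -!lock scalerA mulfV ?lt0r_neq0// scale1r.
by rewrite cosh_hdist /hdir scaleNr addrC addrK.
Qed.

Lemma mdot_htan x y : mdot x (htan x y) = 0.
Proof. by rewrite /htan -!lock /hdir !mdotE mdot_H2; ring. Qed.

Lemma mdot_hdir x y : mdot (hdir x y) (hdir x y) = sinh (hdist x y) ^+ 2.
Proof.
rewrite /hdir !mdotE !mdot_H2 (mdotC y x).
have := cosh2_sinh2 (hdist x y); rewrite cosh_hdist; nra.
Qed.

Lemma htan_norm x y : x <> y -> mdot (htan x y) (htan x y) = 1.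
Proof.
move=> /sinh_hdist_gt0 s0; rewrite /htan -!lock !mdotZl !mdotZr mdot_hdir.
by field; rewrite lt0r_neq0.
Qed.

Lemma htan_orth x y N : mdot x N = 0 -> mdot y N = 0 -> mdot (htan x y) N = 0.
Proof. by move=> xN yN; rewrite /htan -!lock /hdir !mdotE xN yN; ring. Qed.

Lemma edge_frame x y N : x <> y -> mdot N N = 1 -> mdot x N = 0 ->
  mdot y N = 0 -> orthoframe x (htan x y) N.
Proof.
by move=> xy NN xN yN; split => //;
  [exact: htan_norm|exact: mdot_htan|exact: htan_orth].
Qed.

(** A unit normal turns incidence with a line into a linear equation, and below, sides into signs of
    [mdot z N]. *)
Lemma hlineP x y z N : x <> y -> mdot N N = 1 -> mdot x N = 0 ->
  mdot y N = 0 -> hline x y z <-> mdot z N = 0.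
Proof.
move=> xy NN xN yN; split=> [[a [b ->]]|zN].
  by rewrite !mdotE xN yN !mulr0 addr0.
have fr := edge_frame xy NN xN yN.
rewrite /hline /= (orthoframe_coord z fr) zN scale0r addr0 /htan -!lock /hdir.
set s := (sinh _)^-1; set t := mdot z (s *: _).
exists (- mdot z x + t * s * mdot x y), (t * s).
by apply/rowP => k; rewrite !mxE; ring.
Qed.

Lemma H2_scale v x : mdot v v < 0 -> mdot v x < 0 ->
  exists z : H2 R, exists2 k : R, 0 < k & hpt z = k *: v.
Proof.
rewrite -oppr_gt0 => vv vx; pose k := (Num.sqrt (- mdot v v))^-1.
have k0 : 0 < k by rewrite invr_gt0 sqrtr_gt0.
have zP : (mdot (k *: v) (k *: v) == - 1) && (0 < (k *: v) 0 0).
  apply: (@H2_sheet _ _ x); last by rewrite mdotZl pmulr_rlt0.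
  have k2 : k ^+ 2 = (- mdot v v)^-1 by rewrite /k exprVn sqr_sqrtr// ltW.
  have -> : mdot (k *: v) (k *: v) = k ^+ 2 * mdot v v.
    by rewrite mdotZl mdotZr; ring.
  by rewrite k2 invrN mulNr mulVf// -oppr_eq0 lt0r_neq0.
by exists (MkH2 zP), k.
Qed.

Lemma H2_normalize p q (a b : R) : 0 <= a -> 0 <= b -> 0 < a + b ->
  exists2 z : H2 R, hsegment p q z &
    exists2 k : R, 0 < k & hpt z = k *: (a *: hpt p + b *: hpt q).
Proof.
move=> a0 b0 ab; set v := a *: hpt p + b *: hpt q.
have pq := mdot_H2_le p q.
have vv : mdot v v < 0.
  rewrite -oppr_gt0 /v !mdotE !mdot_H2 (mdotC q p).
  have : 0 < (a + b) ^+ 2 by rewrite exprn_gt0.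
  have : 0 <= a * b * (- mdot p q - 1) by rewrite mulr_ge0 ?mulr_ge0//; lra.
  by nra.
have vp : mdot v p < 0.
  rewrite /v !mdotE mdot_H2 (mdotC q p).
  have : 0 <= b * (- mdot p q - 1) by rewrite mulr_ge0//; lra.
  by nra.
have [z [k k0 zE]] := H2_scale vv vp; exists z; last by exists k.
exists (k * a), (k * b); split; rewrite ?mulr_ge0// ?ltW//.
by rewrite zE /v scalerDr !scalerA.
Qed.

Lemma same_sideP x y p q N : x <> y -> mdot N N = 1 -> mdot x N = 0 ->
  mdot y N = 0 -> same_side (hline x y) p q <-> 0 < mdot p N * mdot q N.
Proof.
move=> xy NN xN yN; split.
  move=> ss; rewrite ltNge; apply/negP => pq.
  (* A nonnegative combination of p and q orthogonal to N; once normalised it is a common point of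
     the segment and the line. *)
  have [a [b [a0 b0 ab e]]] : exists a b : R,
      [/\ 0 <= a, 0 <= b, 0 < a + b & a * mdot p N + b * mdot q N = 0].
    have [p0|p0] := eqVneq (mdot p N) 0.
      by exists 1, 0; rewrite p0; split; lra.
    exists `|mdot q N|, `|mdot p N|; split=> //.
      by have := normr_ge0 (mdot q N); rewrite -normr_gt0 in p0; lra.
    have [pp|pn] : mdot p N > 0 \/ mdot p N < 0.
      by move: p0; rewrite neq_lt => /orP[]; [right|left].
    - have qn : mdot q N <= 0 by rewrite -(pmulr_rle0 _ pp).
      by rewrite ler0_norm// gtr0_norm//; ring.
    - have qn : 0 <= mdot q N by rewrite -(nmulr_rle0 _ pn).
      by rewrite ger0_norm// ltr0_norm//; ring.
  have [z zs [k k0 zE]] := H2_normalize p q a0 b0 ab.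
  suff : (hsegment p q `&` hline x y) z by rewrite ss.
  by split=> //; apply/(hlineP z xy NN xN yN); rewrite zE mdotZl !mdotE e mulr0.
move=> pq; rewrite /same_side -subset0 => z [[a [b [a0 b0 zE]]]].
move=> /(hlineP z xy NN xN yN); rewrite zE !mdotE => e.
have pa : a * mdot p N * (mdot q N) + b * mdot q N ^+ 2 = 0.
  by transitivity ((a * mdot p N + b * mdot q N) * mdot q N); [ring|rewrite e mul0r].
have q0 : 0 < mdot q N ^+ 2.
  by rewrite lt0r sqr_ge0 andbT sqrf_eq0; apply/eqP => q0; rewrite q0 mulr0 ltxx in pq.
have za : a = 0 by nra.
have zb : b = 0 by nra.
by have := mdot_H2 z; rewrite zE za zb !scale0r add0r /mdot !mxE; lra.
Qed.

End Lines.

(** From i0 one climbs to the last label, wraps around to 0, and climbs from there to any label. *)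
Lemma ordS_ind n (Q : 'I_n -> Prop) (i0 : 'I_n) :
  Q i0 -> (forall i, Q i -> Q (ordS i)) -> forall i, Q i.
Proof.
move=> Q0 QS.
have h (i : 'I_n) k : (i + k < n)%N -> Q i ->
    forall j : 'I_n, j = (i + k)%N :> nat -> Q j.
  elim: k => [|k IH] ik Qi j; rewrite ?addn0 ?addnS => ji.
    by rewrite (_ : j = i)//; apply/val_inj.
  have ik' : (i + k < n)%N by rewrite (ltn_trans _ ik)// addnS.
  have := QS _ (IH ik' Qi (Ordinal ik') erefl).
  congr Q; apply: ord_inj; rewrite ordSE ji /=.
  by case: eqP => // e; move: ik; rewrite addnS e ltnn.
have n0 : (0 < n)%N by exact: leq_ltn_trans (leq0n i0) (ltn_ord i0).
have n1 : (n.-1 < n)%N by rewrite prednK.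
have Ql : Q (Ordinal n1).
  by apply: (h i0 (n.-1 - i0)%N) => //=; have := ltn_ord i0; lia.
have Qf : Q (Ordinal n0).
  have := QS _ Ql; congr Q; apply: ord_inj.
  by rewrite ordSE /= prednK// eqxx.
by move=> i; apply: (h (Ordinal n0) i) => //=; rewrite add0n ltn_ord.
Qed.

Section Angles.
Variable R : realType.
Implicit Types (N : 'rV[R]_3) (x y z : H2 R).

Lemma hdistC x y : hdist x y = hdist y x.
Proof. by rewrite /hdist mdotC. Qed.

Lemma htan_opp x y : x <> y ->
  htan y x = - (sinh (hdist x y) *: hpt x + cosh (hdist x y) *: htan x y).
Proof.
move=> xy; have s0 := sinh_hdist_gt0 xy.
have ch := cosh2_sinh2 (hdist x y).
rewrite {1}/htan -lock /hdir (hdistC y) (mdotC y) -[mdot x y]opprK -cosh_hdist.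
rewrite (htan_end xy).
move: ch s0; move: (sinh _) (cosh _) (htan x y) => s c E ch s0.
have {}ch : c ^+ 2 = 1 + s ^+ 2 by lra.
by apply/rowP => k; rewrite !mxE; field: ch; rewrite lt0r_neq0.
Qed.

Lemma hangleE x y z : x <> y -> x <> z ->
  hangle x y z = acos (mdot (htan x y) (htan x z)).
Proof.
move=> xy xz; rewrite /hangle !mdot_hdir !sqrtr_sqr.
have s1 := sinh_hdist_gt0 xy; have s2 := sinh_hdist_gt0 xz.
by rewrite !gtr0_norm// /htan -!lock mdotZl mdotZr invfM; congr acos; ring.
Qed.

End Angles.

(** * Inward normals and the frame moving along the boundary *)

Section Normals.
Variables (R : realType) (n : nat).
Hypothesis n3 : (3 <= n)%N.
Implicit Types (P Q : 'I_n -> H2 R) (N : 'I_n -> 'rV[R]_3) (i j : 'I_n).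

Definition inward_normals P N : Prop := forall i,
  [/\ mdot (N i) (N i) = 1, mdot (P i) (N i) = 0, mdot (P (ordS i)) (N i) = 0
    & forall j, off_edge i j -> 0 < mdot (P j) (N i)].

(** The Lorentz cross product of the endpoints has norm sinh of their distance, hence a unit normal.
    Vertex i+2 fixes its sign, and convexity gives all other vertices off the edge the same sign. *)
Lemma convex_inward_normals P : convex_polygon P ->
  exists N, inward_normals P N.
Proof.
case=> _ Pne Pss.
suff h : forall i, exists N : 'rV[R]_3,
  [/\ mdot N N = 1, mdot (P i) N = 0, mdot (P (ordS i)) N = 0
    & forall j, off_edge i j -> 0 < mdot (P j) N].
  by have [N hN] := choice h; exists N.
move=> i; set x := P i; set y := P (ordS i); have xy : x <> y := Pne i.
have [N [NN xN yN]] : exists N : 'rV[R]_3,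
    [/\ mdot N N = 1, mdot x N = 0 & mdot y N = 0].
  pose s := sinh (hdist x y); have s0 : 0 < s := sinh_hdist_gt0 xy.
  exists (s^-1 *: mcross x y).
  rewrite !mdotE (mdotC x (mcross _ _)) (mdotC y (mcross _ _)) mcross_l mcross_r.
  rewrite mcross_norm !mdot_H2.
  split; rewrite ?mulr0//.
  have -> : mdot x y ^+ 2 - -1 * -1 = s ^+ 2.
    by have := cosh2_sinh2 (hdist x y); rewrite -/s cosh_hdist; nra.
  by field; rewrite lt0r_neq0.
have ss j := same_sideP (P (ordS (ordS i))) (P j) xy NN xN yN.
have off := off_edge_SS i n3.
have pos j : off_edge i j -> 0 < mdot (P (ordS (ordS i))) N * mdot (P j) N.
  by move=> oj; apply/ss/Pss.
have := pos _ off; set a := mdot (P (ordS (ordS i))) N => aa.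
have [a0|a0|a0] := ltgtP a 0.
- exists (- N); rewrite !(mdotNl, mdotNr) xN yN NN oppr0 opprK; split=> // j /pos.
  by rewrite -/a mdotNr nmulr_rgt0// oppr_gt0.
- by exists N; split=> // j /pos; rewrite -/a pmulr_rgt0.
- by move: aa; rewrite a0 mul0r ltxx.
Qed.

Lemma inward_normals_convex P N : (forall i, P i <> P (ordS i)) ->
  inward_normals P N -> convex_polygon P.
Proof.
move=> Pne PN; split=> // i j k ij ik.
have [NN xN yN pos] := PN i.
by apply/(same_sideP _ _ (Pne i) NN xN yN); rewrite mulr_gt0// pos.
Qed.

Lemma regionP P N z : convex_polygon P -> inward_normals P N ->
  region P z <-> forall i, 0 <= mdot z (N i).
Proof.
case=> _ Pne _ PN; split=> [Rz i|Rz i]; have [NN xN yN pos] := PN i.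
  have [/(hlineP _ (Pne i) NN xN yN) -> //|ss] := Rz i.
  have off := off_edge_SS i n3.
  have /(same_sideP _ _ (Pne i) NN xN yN) := ss _ off.
  by rewrite pmulr_lgt0 ?pos// => /ltW.
have := Rz i; rewrite le_eqVlt => /orP[/eqP e|z0].
  by left; apply/(hlineP _ (Pne i) NN xN yN).
by right => j ij; apply/(same_sideP _ _ (Pne i) NN xN yN); rewrite mulr_gt0// pos.
Qed.

Definition etan P i : 'rV[R]_3 := htan (P i) (P (ordS i)).

(** The unit tangent of edge i transported to its far endpoint; locked for the same reason as
    [htan]. *)
Definition etan_end P i : 'rV[R]_3 :=
  locked (sinh (edge_length P i) *: hpt (P i) +
          cosh (edge_length P i) *: etan P i).

Section Frames.
Variables (P : 'I_n -> H2 R) (N : 'I_n -> 'rV[R]_3).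
Hypothesis (Pne : forall i, P i <> P (ordS i)) (PN : inward_normals P N).

Lemma start_frame i : orthoframe (P i) (etan P i) (N i).
Proof. by have [NN xN yN _] := PN i; apply: edge_frame. Qed.

Lemma end_frame i : orthoframe (P (ordS i)) (etan_end P i) (N i).
Proof.
have [NN xN yN _] := PN i.
have -> : etan_end P i = - htan (P (ordS i)) (P i).
  by rewrite htan_opp// opprK /etan_end -lock.
have xy : P (ordS i) <> P i by move/esym/Pne.
split=> //; first by rewrite mdotNl mdotNr opprK htan_norm.
- by rewrite mdotNr mdot_htan oppr0.
- by rewrite mdotNl htan_orth// oppr0.
Qed.

Lemma edge_end i : hpt (P (ordS i)) =
  cosh (edge_length P i) *: hpt (P i) + sinh (edge_length P i) *: etan P i.
Proof. exact: htan_end. Qed.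

Lemma edge_start i : hpt (P i) =
  cosh (edge_length P i) *: hpt (P (ordS i)) - sinh (edge_length P i) *: etan_end P i.
Proof.
rewrite edge_end /etan_end -lock; have := cosh2_sinh2 (edge_length P i).
move: (cosh _) (sinh _) (etan P i) => c s E cs.
have {}cs : c ^+ 2 = 1 + s ^+ 2 by lra.
by apply/rowP => k; rewrite !mxE; ring: cs.
Qed.

Lemma angleE i : angle P (ordS i) =
  acos (- mdot (etan_end P i) (etan P (ordS i))).
Proof.
rewrite /angle ordSK hangleE//; last by move/esym/Pne.
by rewrite htan_opp// mdotNl /etan_end -lock.
Qed.

Lemma cos_angle i : mdot (etan_end P i) (etan P (ordS i)) = - cos (angle P (ordS i)).
Proof.
rewrite angleE acosK ?opprK// in_itv/=.
have [uu _ _ _ _] := start_frame (ordS i).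
have [_ _ _ xN _] := end_frame i.
have := orthoframe_mdot (etan P (ordS i)) (etan P (ordS i)) (end_frame i).
rewrite uu [mdot _ (hpt _)]mdotC mdot_htan [mdot _ (etan_end _ _)]mdotC.
by move: (mdot _ _) (mdot _ _) => a b; nra.
Qed.

(** At a vertex the frame turns by the exterior angle. The angle gives the tangential component; the
    normal one is then known up to sign, and it is positive because vertex i+2 lies on the inner
    side of edge i. *)
Lemma etan_step i : 0 < angle P (ordS i) < pi -> etan P (ordS i) =
  - cos (angle P (ordS i)) *: etan_end P i + sin (angle P (ordS i)) *: N i.
Proof.
move=> th; have [uu _ xE _ _] := start_frame (ordS i).
have sth := sin_gt0_pi th.
rewrite {1}(orthoframe_coord (etan P (ordS i)) (end_frame i)).
rewrite [mdot _ (hpt _)]mdotC xE oppr0 scale0r add0r.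
rewrite [mdot _ (etan_end _ _)]mdotC cos_angle; congr (_ + _ *: _).
have := orthoframe_mdot (etan P (ordS i)) (etan P (ordS i)) (end_frame i).
rewrite uu [mdot _ (hpt _)]mdotC xE [mdot _ (etan_end _ _)]mdotC cos_angle.
have : 0 < mdot (etan P (ordS i)) (N i).
  have [_ _ yN pos] := PN i; have := pos _ (off_edge_SS i n3).
  rewrite edge_end !mdotE yN mulr0 add0r pmulr_rgt0//.
  exact/sinh_hdist_gt0.
have := cos2Dsin2 (angle P (ordS i)).
by move: (mdot _ _) (cos _) (sin _) sth => a c s s0; nra.
Qed.

(** Here the sign comes from vertex i lying on the inner side of edge i+1. *)
Lemma normal_step i : 0 < angle P (ordS i) < pi -> N (ordS i) =
  - cos (angle P (ordS i)) *: N i - sin (angle P (ordS i)) *: etan_end P i.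
Proof.
move=> th; have sth := sin_gt0_pi th; have [_ NN xE xN EN] := start_frame (ordS i).
have step := etan_step th.
have [_ _ _ pos] := PN (ordS i).
have := pos _ (off_edge_S i n3); rewrite edge_start !mdotE xN mulr0 sub0r => posi.
have l0 : 0 < sinh (edge_length P i) by exact/sinh_hdist_gt0.
have e0 : mdot (etan_end P i) (N (ordS i)) < 0.
  by rewrite -(pmulr_rlt0 _ l0); move: posi; lra.
have EN' : - cos (angle P (ordS i)) * mdot (etan_end P i) (N (ordS i))
   + sin (angle P (ordS i)) * mdot (N i) (N (ordS i)) = 0.
  by rewrite -EN step !mdotE.
have := orthoframe_mdot (N (ordS i)) (N (ordS i)) (end_frame i).
rewrite NN [mdot _ (hpt _)]mdotC xN [mdot _ (etan_end _ _)]mdotC [mdot _ (N i)]mdotC.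
rewrite {5}(orthoframe_coord (N (ordS i)) (end_frame i)).
rewrite [mdot _ (hpt _)]mdotC xN [mdot _ (etan_end _ _)]mdotC [mdot _ (N i)]mdotC.
move: EN' e0; have := cos2Dsin2 (angle P (ordS i)).
move: (mdot _ _) (mdot (N i) _) (cos _) (sin _) sth => a b c s s0 cs1 e a0 ab1.
have ha : a = - s.
  have : a ^+ 2 = s ^+ 2.
    have e2 : s * b = c * a by lra.
    have e3 : s ^+ 2 * b ^+ 2 = c ^+ 2 * a ^+ 2 by rewrite -!exprMn e2.
    have -> : a ^+ 2 = (c ^+ 2 + s ^+ 2) * a ^+ 2 by rewrite cs1 mul1r.
    rewrite mulrDl -e3 -mulrDr (_ : b ^+ 2 + a ^+ 2 = 1) ?mulr1//.
    by rewrite ab1; ring.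
  by move=> /eqP; rewrite eqf_sqr => /orP[/eqP|/eqP]; lra.
have hb : b = - c.
  by apply: (mulfI (lt0r_neq0 s0)); move: e; rewrite ha; lra.
by rewrite ha hb oppr0 scale0r add0r scaleNr addrC.
Qed.

End Frames.

End Normals.

Section Congruence.
Variable R : realType.

Lemma frame_map_lin (p p' : H2 R) (u v u' v' w w' : 'rV[R]_3) (a b : R) :
  frame_map p u v p' u' v' (a *: w + b *: w') =
  a *: frame_map p u v p' u' v' w + b *: frame_map p u v p' u' v' w'.
Proof.
rewrite /frame_map !mdotE.
by apply/rowP => k; rewrite !mxE; ring.
Qed.

Variables (n : nat) (theta : 'I_n -> R).
Hypothesis (n3 : (3 <= n)%N) (theta0 : forall i, 0 < theta i < pi).
Implicit Types P Q : 'I_n -> H2 R.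

(** An isometry matches the frames at vertex 0. The frame at each next vertex is a linear expression
    in the previous one whose coefficients depend only on lengths and angles, so the agreement
    propagates around the polygon. *)
Lemma congruent_edge_length P Q :
  polygons_with_angles theta P -> polygons_with_angles theta Q ->
  (forall i, edge_length P i = edge_length Q i) -> congruent P Q.
Proof.
move=> [cP aP] [cQ aQ] PQ.
have [N PN] := convex_inward_normals n3 cP.
have [M QM] := convex_inward_normals n3 cQ.
have [_ Pne _] := cP; have [_ Qne _] := cQ.
have n0 : (0 < n)%N by exact: leq_trans n3.
pose i0 := Ordinal n0.
have frP := start_frame Pne PN i0; have frQ := start_frame Qne QM i0.
have [f fiso fE] := frame_isometry frP frQ; exists f; split=> //.
set F := frame_map _ _ _ _ _ _ in fE.
have lin a b w w' : F (a *: w + b *: w') = a *: F w + b *: F w'.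
  exact: frame_map_lin.
suff h i : [/\ F (P i) = hpt (Q i), F (etan P i) = etan Q i & F (N i) = M i].
  by move=> i; apply/H2_inj; rewrite fE; case: (h i).
pose K i := [/\ F (P i) = hpt (Q i), F (etan P i) = etan Q i & F (N i) = M i].
apply: (@ordS_ind n K i0) => {i} [|i [F1 F2 F3]].
  have [uu vv pu pv uv] := frP; rewrite /K /F /frame_map mdot_H2 uu vv.
  rewrite ![mdot _ (hpt _)]mdotC pu pv uv (mdotC (N i0)) uv.
  by rewrite !(scale0r, oppr0, addr0, add0r, opprK, scale1r).
have Fend : F (etan_end P i) = etan_end Q i.
  by rewrite /etan_end -!lock lin F1 F2 PQ.
split.
- by rewrite (edge_end Pne) (edge_end Qne) lin F1 F2 PQ.
- rewrite (etan_step n3 Pne PN) ?aP// (etan_step n3 Qne QM) ?aQ//.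
  by rewrite lin Fend F3.
- rewrite (normal_step n3 Pne PN) ?aP// (normal_step n3 Qne QM) ?aQ//.
  by rewrite -!scaleNr lin Fend F3.
Qed.

End Congruence.

(** * Trigonometry of the quadrilateral at a vertex *)

Section Vertex.
Variable R : realType.
Implicit Types a b t : R.

(* In the quadrilateral cut out at a vertex of angle t by the perpendiculars
   from a point to the two adjacent edges, at distances arsinh a and arsinh b:
   the angle at the point and the distances from the vertex to the two feet. *)
Definition vdisc t a b : R :=
  Num.sqrt (1 + a ^+ 2 + b ^+ 2 + 2 * a * b * cos t - cos t ^+ 2).
Definition vcosh a : R := Num.sqrt (1 + a ^+ 2).
Definition vcos t a b : R := (a * b - cos t) / (vcosh a * vcosh b).
Definition vangle t a b : R := acos (vcos t a b).
Definition vfoot t a b : R := asinh ((b + a * cos t) / (sin t * vcosh a)).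

Lemma vcosh_gt0 a : 0 < vcosh a.
Proof. by rewrite sqrtr_gt0; have := sqr_ge0 a; lra. Qed.

Lemma vcosh_sqr a : vcosh a ^+ 2 = 1 + a ^+ 2.
Proof. by rewrite sqr_sqrtr//; have := sqr_ge0 a; lra. Qed.

Lemma vdiscC t a b : vdisc t a b = vdisc t b a.
Proof. by congr Num.sqrt; ring. Qed.

(** The radicand is [(a + b cos t)^2 + (1 + b^2) sin^2 t]. It is minus the Gram determinant of a
    point and two unit normals whose product is - cos t, with a and b the pairings of the point with
    the normals. *)
Lemma vdisc_sqr t a b : vdisc t a b ^+ 2 =
  1 + a ^+ 2 + b ^+ 2 + 2 * a * b * cos t - cos t ^+ 2.
Proof.
rewrite sqr_sqrtr//; have := cos2Dsin2 t; have := sqr_ge0 (sin t).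
by have := sqr_ge0 (a + b * cos t); have := sqr_ge0 (b * sin t); nra.
Qed.

Section Sin.
Variable t : R.
Hypothesis t0 : 0 < t < pi.

Let st0 : 0 < sin t. Proof. exact: sin_gt0_pi. Qed.

Lemma vdisc_gt0 a b : 0 < vdisc t a b.
Proof.
rewrite sqrtr_gt0; have := cos2Dsin2 t; have := exprn_gt0 2 st0.
by have := sqr_ge0 (a + b * cos t); have := sqr_ge0 (b * sin t); nra.
Qed.

(** The square of the denominator minus that of the numerator is exactly [vdisc^2]; the same
    identity gives [sin_vangle]. *)
Lemma vcos_itv a b : -1 < vcos t a b < 1.
Proof.
suff : vcos t a b ^+ 2 < 1 by move=> h; apply/andP; split; nra.
rewrite /vcos expr_div_n exprMn !vcosh_sqr.
rewrite ltr_pdivrMr ?mul1r; last first.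
  by rewrite mulr_gt0//; have := sqr_ge0 a; have := sqr_ge0 b; lra.
by have := exprn_gt0 2 (vdisc_gt0 a b); rewrite vdisc_sqr; nra.
Qed.

Lemma vangle_itv a b : 0 < vangle t a b < pi.
Proof.
have /andP[h1 h2] := vcos_itv a b.
by rewrite acos_gt0 ?acos_ltpi// ?h1 ?h2// ltW.
Qed.

Lemma cos_vangle a b : cos (vangle t a b) = vcos t a b.
Proof. by have /andP[h1 h2] := vcos_itv a b; rewrite acosK// in_itv/= !ltW. Qed.

Lemma sin_vangle a b :
  sin (vangle t a b) = vdisc t a b / (vcosh a * vcosh b).
Proof.
have /andP[h1 h2] := vcos_itv a b; rewrite sin_acos ?ltW//.
have a0 := vcosh_gt0 a; have b0 := vcosh_gt0 b.
apply: sqrtr_eqP; first by rewrite divr_ge0// ltW ?mulr_gt0// vdisc_gt0.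
rewrite /vcos !expr_div_n vdisc_sqr.
have e : (vcosh a * vcosh b) ^+ 2 = (1 + a ^+ 2) * (1 + b ^+ 2).
  by rewrite exprMn !vcosh_sqr.
rewrite e; field; apply/andP; split; apply: lt0r_neq0;
  by [have := sqr_ge0 a; lra|have := sqr_ge0 b; lra].
Qed.

Lemma cosh_vfoot a b : cosh (vfoot t a b) = vdisc t a b / (sin t * vcosh a).
Proof.
have a0 := vcosh_gt0 a.
rewrite cosh_asinh; apply: sqrtr_eqP.
  by rewrite divr_ge0// ltW ?mulr_gt0// vdisc_gt0.
rewrite !expr_div_n vdisc_sqr exprMn vcosh_sqr.
have cs : cos t ^+ 2 = 1 - sin t ^+ 2 by rewrite cos2sin2.
have ha : 1 + a ^+ 2 != 0 by rewrite lt0r_neq0//; have := sqr_ge0 a; lra.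
by field: cs; rewrite ?ha (lt0r_neq0 st0).
Qed.

Lemma sinh_vfoot a b :
  sinh (vfoot t a b) = (b + a * cos t) / (sin t * vcosh a).
Proof. exact: sinh_asinh. Qed.

End Sin.

End Vertex.

(** * Exactly one revolution *)

Section AngleSum.
Variable R : realType.

Lemma cos_lt1 (x : R) : 0 < x < 2 * pi -> cos x < 1.
Proof.
move=> /andP[x0 x2]; have : 0 < sin (x / 2).
  by apply: sin_gt0_pi; rewrite divr_gt0// ltr_pdivrMr//; lra.
have : cos x = 1 - 2 * sin (x / 2) ^+ 2.
  rewrite {1}(_ : x = (x / 2) *+ 2); last by rewrite mulr2n; lra.
  by rewrite cos_mulr2n cos2sin2 mulr2n; ring.
by move=> -> s0; have := exprn_gt0 2 s0; lra.
Qed.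

Lemma cosB2pi (x : R) : cos (x - 2 * pi) = cos x.
Proof. by rewrite -[in RHS](subrK (2 * pi) x) mulr_natl cosD2pi. Qed.

Lemma sinB2pi (x : R) : sin (x - 2 * pi) = sin x.
Proof. by rewrite -[in RHS](subrK (2 * pi) x) mulr_natl sinD2pi. Qed.

(** Below 2 pi the cosine could not be 1 at n. If psi n exceeded 2 pi, consider the first j+1 with
    psi at least 2 pi: the last hypothesis excludes j+1 < n, and for j+1 = n the value psi n lies
    strictly between 2 pi and 3 pi, where the cosine is not 1. *)
Lemma turn_once (psi : nat -> R) n : psi 0%N = 0 ->
  (forall k, 0 < psi k.+1 - psi k < pi) -> (0 < n)%N -> cos (psi n) = 1 ->
  (forall j, (2 <= j)%N -> (j.+1 < n)%N ->
     psi j < 2 * pi -> 2 * pi <= psi j.+1 -> False) ->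
  psi n = 2 * pi.
Proof.
move=> p0 dp n0 cn H.
have pgt k : 0 < psi k.+1.
  by elim: k => [|k IH]; [have := dp 0%N; rewrite p0|have := dp k.+1]; lra.
have pn : 0 < psi n by case: (n) n0 => // k _.
have [lt2|gt2|//] := ltgtP (psi n) (2 * pi).
  by have := @cos_lt1 (psi n); rewrite pn lt2 cn ltxx => /(_ isT).
have ex : exists j, 2 * pi <= psi j by exists n; exact: ltW.
case: (ex_minnP ex) => -[|j] pj jmin.
  by have := @pi_gt0 R; rewrite p0 in pj; lra.
have pj' : psi j < 2 * pi.
  by rewrite ltNge; apply/negP => /jmin; rewrite ltnn.
have jn := jmin _ (ltW gt2).
have j2 : (2 <= j)%N.
  by case: j pj {jmin pj' jn} => [|[|//]] pj; have := dp 0%N; have := dp 1%N; lra.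
move: jn; rewrite leq_eqVlt => /orP[/eqP jn|jn]; last by case: (H j).
have hn : 0 < psi n - 2 * pi < 2 * pi by have := dp j; rewrite jn; lra.
by have := cos_lt1 hn; rewrite cosB2pi cn ltxx.
Qed.

End AngleSum.

Section IndexIteration.
Variable (n : nat).
Hypothesis n0 : (0 < n)%N.

Definition nord (k : nat) : 'I_n := iter k (@ordS n) (Ordinal n0).

Lemma nordS k : nord k.+1 = ordS (nord k). Proof. by []. Qed.

Lemma nordE k : nord k = (k %% n)%N :> nat.
Proof.
elim: k => [|k IH]; first by rewrite mod0n.
by rewrite nordS /= IH -addn1 modnDml addn1.
Qed.

Lemma nord_small k : (k < n)%N -> nord k = k :> nat.
Proof. by move=> kn; rewrite nordE modn_small. Qed.

Lemma nord_ord (i : 'I_n) : nord i = i.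
Proof. by apply: ord_inj; rewrite nord_small. Qed.

Lemma nordDn k : nord (k + n) = nord k.
Proof. by apply: ord_inj; rewrite !nordE modnDr. Qed.

End IndexIteration.

Section Rotation.
Variable R : realType.

(** Here e is the normal N projected orthogonally to q and normalised, and D completes it to an
    orthonormal basis of the tangent plane at q. Passing the vertex v to the next edge rotates this
    basis by the angle with cosine C and sine S. *)
Lemma rotate_step (a b c s k x ca cb : R) (v X N : 'rV[R]_3) :
  0 < ca -> 0 < cb -> ca ^+ 2 = 1 + a ^+ 2 -> k ^+ 2 = 1 + x ^+ 2 + a ^+ 2 ->
  c ^+ 2 = 1 - s ^+ 2 -> b = - c * a - s * x ->
  let q := k *: v + x *: X + a *: N in
  let N' := - c *: N - s *: X in
  let D := ca^-1 *: (k *: X + x *: v) in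
  let e := ca^-1 *: (N + a *: q) in
  let D' := cb^-1 *: (k *: (- c *: X + s *: N) + (- c * x + s * a) *: v) in
  let e' := cb^-1 *: (N' + b *: q) in
  let C := (a * b - c) / (ca * cb) in
  let S := s * k / (ca * cb) in
  e' = C *: e - S *: D /\ D' = C *: D + S *: e.
Proof.
move=> ca0 cb0 hca hk hc -> q N' D e D' e' C S.
rewrite /e' /e /D' /D /C /S /q /N'.
have ca0' := lt0r_neq0 ca0; have cb0' := lt0r_neq0 cb0.
split; apply/rowP => j; rewrite !mxE.
  by field: hca hk hc; rewrite ca0' cb0'.
by field: hca hk hc; rewrite ca0' cb0'.
Qed.

End Rotation.

(** * Polygons seen from an interior point *)

(* If the normals turned around q more than once, then normal 0 would be a
   combination be N_(j-1) + ga N_j + C q with be, ga >= 0, up to positive factors;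
   pairing it with vertex j gives C < 0, with vertex 0 it gives C > 0. *)
Lemma cone_absurd (R : realType) (al be ga b0 b1 b2 s0 s1 s2 m02 m1 m2 x0 x2 : R) :
  0 < al -> 0 <= be -> 0 < ga -> 0 < b0 -> 0 < b1 -> 0 < b2 ->
  0 < m02 -> 0 <= m1 -> 0 <= m2 -> x0 < 0 -> x2 < 0 ->
  al * (b0 * (m02 + s0 * x2)) = be * (b1 * (s1 * x2)) + ga * (b2 * (s2 * x2)) ->
  al * (b0 * (s0 * x0)) =
    be * (b1 * (m1 + s1 * x0)) + ga * (b2 * (m2 + s2 * x0)) -> False.
Proof.
move=> al0 be0 ga0 b00 b10 b20 m020 m10 m20 x00 x20 e2 e0.
pose C := be * b1 * s1 + ga * b2 * s2 - al * b0 * s0.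
have C0 : C < 0.
  have : C * x2 = al * b0 * m02 by rewrite /C; lra.
  have : 0 < al * b0 * m02 by rewrite !mulr_gt0.
  by nra.
have : C * x0 = - (be * b1 * m1 + ga * b2 * m2) by rewrite /C; lra.
have : 0 <= be * b1 * m1 by rewrite mulr_ge0// mulr_ge0// ltW.
have : 0 <= ga * b2 * m2 by rewrite mulr_ge0// mulr_ge0// ltW.
have : 0 < C * x0 by rewrite nmulr_rgt0.
lra.
Qed.

Section SupportData.
Variables (R : realType) (n : nat) (theta : 'I_n -> R).
Implicit Types (s w : 'I_n -> R) (i : 'I_n).

Definition foot_start s i : R := vfoot (theta i) (s i) (s (ord_pred i)).
Definition foot_end s i : R := vfoot (theta (ordS i)) (s i) (s (ordS i)).
Definition support_length s i : R := foot_start s i + foot_end s i.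
Definition turn s i : R := vangle (theta (ordS i)) (s i) (s (ordS i)).
Definition total_angle s : R := \sum_i turn s i.

Hypothesis (n3 : (3 <= n)%N) (theta0 : forall i, 0 < theta i < pi).

Lemma foot_startS s i :
  foot_start s (ordS i) = vfoot (theta (ordS i)) (s (ordS i)) (s i).
Proof. by rewrite /foot_start ordSK. Qed.

Section Pointed.
Variables (P : 'I_n -> H2 R) (N : 'I_n -> 'rV[R]_3) (q : H2 R).
Hypothesis (cP : convex_polygon P) (aP : forall i, angle P i = theta i).
Hypothesis (PN : inward_normals P N).

Let s i := mdot q (N i).
Let Pne i : P i <> P (ordS i). Proof. by case: cP. Qed.

Let sin_theta i : 0 < sin (theta i). Proof. exact: sin_gt0_pi. Qed.

(** Pairing [normal_step] with q expresses the tangential coordinate of q through the support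
    numbers of two adjacent edges. *)
Lemma pointed_end_tan i :
  mdot q (etan_end P i) = - (vcosh (s i) * sinh (foot_end s i)).
Proof.
have st := lt0r_neq0 (sin_theta (ordS i)).
have ca := lt0r_neq0 (vcosh_gt0 (s i)).
have e : s (ordS i) = - cos (theta (ordS i)) * s i
    - sin (theta (ordS i)) * mdot q (etan_end P i).
  by rewrite {1}/s (normal_step n3 Pne PN) ?aP// -scaleNr !mdotE /s; ring.
by rewrite /foot_end sinh_vfoot// e; field; rewrite st ca.
Qed.

Lemma pointed_start_tan i :
  mdot q (etan P i) = vcosh (s i) * sinh (foot_start s i).
Proof.
rewrite -(ord_predK i); set j := ord_pred i.
have st := lt0r_neq0 (sin_theta (ordS j)).
have ca := lt0r_neq0 (vcosh_gt0 (s (ordS j))).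
rewrite foot_startS sinh_vfoot// (etan_step n3 Pne PN) ?aP// !mdotE.
have e : s (ordS j) = - cos (theta (ordS j)) * s j
    - sin (theta (ordS j)) * mdot q (etan_end P j).
  by rewrite {1}/s (normal_step n3 Pne PN) ?aP// -scaleNr !mdotE /s; ring.
have cs : cos (theta (ordS j)) ^+ 2 = 1 - sin (theta (ordS j)) ^+ 2 by rewrite cos2sin2.
move: ca; rewrite -/(s j) => ca.
transitivity ((s j + s (ordS j) * cos (theta (ordS j))) / sin (theta (ordS j))).
  by rewrite e; field: cs; rewrite st.
by field; rewrite st ca.
Qed.

(** The timelike coordinate follows from the other two, since [mdot q q = - 1] and [mdot q v] is
    negative. *)
Lemma frame_cosh (v : H2 R) (X M : 'rV[R]_3) x : orthoframe v X M ->
  mdot q X ^+ 2 = (vcosh (mdot q M) * sinh x) ^+ 2 ->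
  mdot q v = - (vcosh (mdot q M) * cosh x).
Proof.
move=> fr qX; apply: oppr_inj; rewrite opprK.
have := orthoframe_mdot q q fr; rewrite mdot_H2 -!expr2 => e.
apply/eqP; rewrite -(@eqrXn2 _ 2)//.
- rewrite sqrrN exprMn; apply/eqP.
  have := cosh2_sinh2 x; move: qX; rewrite exprMn vcosh_sqr.
  by move: e; move: (cosh x) (sinh x) => c sh; nra.
- by have := mdot_H2_le q v; lra.
- by rewrite ltW// mulr_gt0// ?vcosh_gt0// cosh_gt0.
Qed.

Lemma pointed_end i :
  mdot q (P (ordS i)) = - (vcosh (s i) * cosh (foot_end s i)).
Proof.
by apply: (frame_cosh (end_frame Pne PN i)); rewrite pointed_end_tan sqrrN.
Qed.

Lemma pointed_start i :
  mdot q (P i) = - (vcosh (s i) * cosh (foot_start s i)).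
Proof.
by apply: (frame_cosh (start_frame Pne PN i)); rewrite pointed_start_tan.
Qed.

(** The tangential coordinate of q at the far end, computed by transport from the near end, gives
    sinh (l - foot_start) = sinh foot_end. *)
Lemma edge_length_support i : edge_length P i = support_length s i.
Proof.
have ca := vcosh_gt0 (s i).
have e := pointed_end_tan i.
rewrite /etan_end -lock !mdotE pointed_start pointed_start_tan in e.
have : sinh (edge_length P i - foot_start s i) = sinh (foot_end s i).
  rewrite sinhD coshN sinhN; apply: (mulfI (lt0r_neq0 ca)).
  by move: e; rewrite /s; nra.
by move/sinh_inj; rewrite /support_length; lra.
Qed.

(** The orthonormal basis at q of [rotate_step] for edge i. Its second vector can be computed at
    either end of the edge, see [tan_end], which links consecutive vertices. *)
Let dir i : 'rV[R]_3 := (vcosh (s i))^-1 *: (N i + s i *: hpt q).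
Let tan i : 'rV[R]_3 := (vcosh (s i))^-1 *:
  (- mdot q (P i) *: etan P i + mdot q (etan P i) *: hpt (P i)).

Lemma tan_end i : tan i = (vcosh (s i))^-1 *:
  (- mdot q (P (ordS i)) *: etan_end P i + mdot q (etan_end P i) *: hpt (P (ordS i))).
Proof.
rewrite /tan; congr (_ *: _).
rewrite (edge_end Pne) /etan_end -lock; have := cosh2_sinh2 (edge_length P i).
rewrite !mdotE; move: (mdot q (P i)) (mdot q _) (cosh _) (sinh _) (etan P i).
move=> a b c d E cd; have {}cd : c ^+ 2 = 1 + d ^+ 2 by lra.
by apply/rowP => k; rewrite !mxE; ring: cd.
Qed.

Lemma dir_rotate i :
  dir (ordS i) = cos (turn s i) *: dir i - sin (turn s i) *: tan i /\
  tan (ordS i) = cos (turn s i) *: tan i + sin (turn s i) *: dir i.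
Proof.
have th := theta0 (ordS i); have st := sin_theta (ordS i).
have fr := end_frame Pne PN i.
pose k := - mdot q (P (ordS i)); pose x := mdot q (etan_end P i).
have qE : hpt q = k *: hpt (P (ordS i)) + x *: etan_end P i + s i *: N i.
  exact: orthoframe_coord.
have hk : k ^+ 2 = 1 + x ^+ 2 + s i ^+ 2.
  have := orthoframe_mdot q q fr; rewrite mdot_H2 -!expr2 sqrrN /x /s.
  by lra.
have hb : s (ordS i) = - cos (theta (ordS i)) * s i - sin (theta (ordS i)) * x.
  by rewrite {1}/s (normal_step n3 Pne PN) ?aP// -scaleNr !mdotE; rewrite /x /s; ring.
have hE : mdot q (etan P (ordS i)) =
    - cos (theta (ordS i)) * x + sin (theta (ordS i)) * s i.
  by rewrite (etan_step n3 Pne PN) ?aP// !mdotE.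
have [] := @rotate_step R (s i) (s (ordS i)) (cos (theta (ordS i)))
  (sin (theta (ordS i))) k x _ _ (hpt (P (ordS i))) (etan_end P i) (N i)
  (vcosh_gt0 _) (vcosh_gt0 (s (ordS i))) (vcosh_sqr _) hk (cos2sin2 _) hb.
rewrite -qE; rewrite /turn (cos_vangle th) (sin_vangle th).
have -> : sin (theta (ordS i)) * k = vdisc (theta (ordS i)) (s i) (s (ordS i)).
  rewrite /k pointed_end opprK /foot_end (cosh_vfoot th).
  by field; rewrite !lt0r_neq0 ?vcosh_gt0.
have -> : - cos (theta (ordS i)) *: N i - sin (theta (ordS i)) *: etan_end P i =
    N (ordS i).
  by rewrite (normal_step n3 Pne PN) ?aP.
have -> : - cos (theta (ordS i)) *: etan_end P i + sin (theta (ordS i)) *: N i =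
    etan P (ordS i) by rewrite (etan_step n3 Pne PN) ?aP.
by rewrite -hE -tan_end -/(dir _) /k -/(tan _).
Qed.

Let n0 : (0 < n)%N. Proof. exact: leq_trans n3. Qed.
Let psi k : R := \sum_(j < k) turn s (nord n0 j).

Lemma dir_psi k :
  dir (nord n0 k) = cos (psi k) *: dir (nord n0 0) - sin (psi k) *: tan (nord n0 0) /\
  tan (nord n0 k) = cos (psi k) *: tan (nord n0 0) + sin (psi k) *: dir (nord n0 0).
Proof.
elim: k => [|k [IH1 IH2]].
  by rewrite /psi big_ord0 cos0 sin0 !scale1r !scale0r subr0 addr0.
have -> : psi k.+1 = psi k + turn s (nord n0 k) by rewrite /psi big_ord_recr.
have [-> ->] := dir_rotate (nord n0 k); rewrite IH1 IH2 cosD sinD.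
by split; apply/rowP => j; rewrite !mxE; ring.
Qed.

Lemma mdot_dir i z :
  mdot (dir i) z = (vcosh (s i))^-1 * (mdot (N i) z + s i * mdot q z).
Proof. by rewrite /dir !mdotE. Qed.

Lemma dir_unit i : mdot (dir i) (dir i) = 1 /\ mdot (dir i) (tan i) = 0.
Proof.
have [NN Pi _ _] := PN i; have [_ _ _ _ EN] := start_frame Pne PN i.
have ca := lt0r_neq0 (vcosh_gt0 (s i)).
have hca := vcosh_sqr (s i).
split.
  rewrite /dir !mdotE mdot_H2 NN (mdotC (N i)) -/(s i).
  by field: hca; rewrite ca.
rewrite /dir /tan !mdotE (mdotC (N i) (etan P i)) EN (mdotC (N i) (P i)) Pi.
by ring.
Qed.

Lemma total_angle_support : (forall i, 0 < s i) -> total_angle s = 2 * pi.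
Proof.
move=> s0.
have -> : total_angle s = psi n.
  by rewrite /total_angle /psi; apply: eq_bigr => i _; rewrite nord_ord.
have turn_itv k : 0 < turn s (nord n0 k) < pi by apply: vangle_itv.
have psiS k : psi k.+1 = psi k + turn s (nord n0 k) by rewrite /psi big_ord_recr.
have c0 i : 0 < (vcosh (s i))^-1 by rewrite invr_gt0 vcosh_gt0.
have PN_ge0 i j : 0 <= mdot (P j) (N i).
  have [_ xN yN pos] := PN i.
  have [->|ji] := eqVneq j i; first by rewrite xN.
  have [->|jSi] := eqVneq j (ordS i); first by rewrite yN.
  by rewrite ltW// pos// /off_edge ji.
apply: turn_once => //.
- by rewrite /psi big_ord0.
- by move=> k; rewrite psiS addrAC subrr add0r.
(* After n steps the basis is back at edge 0, so the rotation by psi n fixes [dir]. *)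
- have [e _] := dir_psi n; have [d1 d0] := dir_unit (nord n0 0).
  have : mdot (dir (nord n0 0)) (dir (nord n0 n)) = 1.
    by rewrite (nordDn n0 0 : nord n0 n = _) d1.
  rewrite e; move: (dir _) (tan _) d1 d0 => u v d1 d0.
  by rewrite -scaleNr !mdotE d1 d0 mulr1 mulr0 addr0.
(* When psi passes 2 pi between j and j+1, direction 0 lies in the cone of directions j and j+1; the
   coefficients beta and gamma come from the sine rule. *)
move=> j j2 jn pj pj1.
set i0 := nord n0 0; set i1 := nord n0 j; set i2 := nord n0 j.+1.
have off : off_edge i0 i2.
  apply/andP; split; apply/eqP => /(congr1 (@nat_of_ord n)).
    by rewrite !nord_small.
  by rewrite ordSE !nord_small//; case: ifP => /eqP; lia.
have [d1 _] := dir_psi j; have [d2 _] := dir_psi j.+1.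
have tj := turn_itv j; have psij := psiS j.
pose beta := sin (psi j.+1); pose gamma := - sin (psi j).
have beta0 : 0 <= beta.
  rewrite /beta -sinB2pi; apply: sin_ge0_pi; lra.
have gamma0 : 0 < gamma.
  by rewrite /gamma -(subrK pi (psi j)) sinDpi opprK; apply: sin_gt0_pi; lra.
have alpha0 : 0 < sin (turn s (nord n0 j)) by apply: sin_gt0_pi.
have dE : sin (turn s (nord n0 j)) *: dir i0 = beta *: dir i1 + gamma *: dir i2.
  rewrite d1 d2 /beta /gamma psij cosD sinD; move: (cos2Dsin2 (psi j)).
  move: (cos (psi j)) (sin (psi j)) (cos (turn s _)) (sin (turn s _)) (dir i0) (tan i0).
  move=> c d c' d' v v' cd.
  have {}cd : c ^+ 2 = 1 - d ^+ 2 by lra.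
  by apply/rowP => k; rewrite !mxE; ring: cd.
have pair z : sin (turn s (nord n0 j)) * mdot (dir i0) z =
    beta * mdot (dir i1) z + gamma * mdot (dir i2) z.
  by rewrite -!mdotZl dE mdotDl.
have qP i : mdot q (P i) < 0 by have := mdot_H2_le q (P i); lra.
have h2 := pair (P i2); have h0 := pair (P i0).
move: h2 h0; rewrite !mdot_dir !(mdotC _ (hpt (P _))) -/i0.
have [_ Pi2 _ _] := PN i2; have [_ _ Pi1 _] := PN i1; have [_ Pi0 _ _] := PN i0.
have [_ _ _ /(_ _ off) Poff] := PN i0.
rewrite Pi2 (Pi1 : mdot (P i2) (N i1) = 0) Pi0 !add0r.
move=> e2 e0; apply: (cone_absurd alpha0 beta0 gamma0 (c0 i0) (c0 i1) (c0 i2)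
  Poff (PN_ge0 i1 i0) (PN_ge0 i2 i0) _ _ e2 e0); rewrite mdotC; exact: qP.
Qed.

End Pointed.

End SupportData.

(** * Polygons with given support data *)

Section AngleOfNormals.
Variables (R : realType) (n : nat).
Hypothesis n3 : (3 <= n)%N.
Variables (P : 'I_n -> H2 R) (N : 'I_n -> 'rV[R]_3).
Hypothesis (Pne : forall i, P i <> P (ordS i)) (PN : inward_normals P N).

Lemma angle_itv i : 0 < angle P (ordS i) < pi.
Proof.
have [uu _ xE _ _] := start_frame Pne PN (ordS i).
have := orthoframe_mdot (etan P (ordS i)) (etan P (ordS i)) (end_frame Pne PN i).
rewrite uu [mdot _ (hpt _)]mdotC xE [mdot _ (etan_end _ _)]mdotC => e.
have g0 : 0 < mdot (etan P (ordS i)) (N i).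
  have [_ _ yN pos] := PN i; have := pos _ (off_edge_SS i n3).
  rewrite (edge_end Pne) !mdotE yN mulr0 add0r pmulr_rgt0//.
  exact/sinh_hdist_gt0.
rewrite (angleE Pne).
set b := mdot (etan_end P i) _ in e *.
have b1 : -1 < - b < 1 by apply/andP; split; nra.
have /andP[h1 h2] := b1.
by rewrite acos_gt0 ?acos_ltpi// ?h1 ?h2// ltW.
Qed.

Lemma cos_angle_normals i : cos (angle P (ordS i)) = - mdot (N i) (N (ordS i)).
Proof.
have [NN _ _ _] := PN i; have [_ _ _ _ EN] := end_frame Pne PN i.
rewrite (normal_step n3 Pne PN (angle_itv i)) -scaleNr !mdotE NN (mdotC (N i)) EN.
by ring.
Qed.

End AngleOfNormals.

Section Standard.
Variables (R : realType) (n : nat) (theta : 'I_n -> R).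
Hypothesis (n3 : (3 <= n)%N) (theta_bound : forall i, 0 < theta i <= pi / 2).
Variable s : 'I_n -> R.
Hypothesis (s0 : forall i, 0 < s i) (stot : total_angle theta s = 2 * pi).
Implicit Types (i j : 'I_n) (k m : nat).

Let theta0 i : 0 < theta i < pi.
Proof. by have := theta_bound i; have := @pi_gt0 R; lra. Qed.

Let n0 : (0 < n)%N. Proof. exact: leq_trans n3. Qed.

Let cost i : 0 <= cos (theta i).
Proof. by apply: cos_ge0_pihalf; have := theta_bound i; have := @pi_gt0 R; lra. Qed.

Definition direction k : R := \sum_(j < k) turn theta s (nord n0 j).

Local Notation psi := direction.

Lemma directionS k : psi k.+1 = psi k + turn theta s (nord n0 k).
Proof. by rewrite /direction big_ord_recr. Qed.

Lemma direction0 : psi 0 = 0. Proof. by rewrite /direction big_ord0. Qed.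

Lemma direction_n : psi n = 2 * pi.
Proof.
rewrite -stot /total_angle /direction.
by apply: eq_bigr => i _; rewrite nord_ord.
Qed.

Lemma directionDn k : psi (k + n) = psi k + 2 * pi.
Proof.
elim: k => [|k IH]; first by rewrite add0n direction_n direction0 add0r.
by rewrite addSn !directionS IH nordDn addrAC.
Qed.

Lemma turn_itv i : 0 < turn theta s i < pi.
Proof. exact: vangle_itv. Qed.

Lemma direction_mod k :
  cos (psi k) = cos (psi (nord n0 k)) /\ sin (psi k) = sin (psi (nord n0 k)).
Proof.
rewrite nordE {1 3}(divn_eq k n) addnC.
elim: (k %/ n)%N => [|m [IH1 IH2]]; first by rewrite mul0n addn0.
by rewrite mulSn addnCA addnC directionDn -cosB2pi -sinB2pi addrK.
Qed.

Lemma direction_ordS i :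
  cos (psi (ordS i)) = cos (psi i + turn theta s i) /\
  sin (psi (ordS i)) = sin (psi i + turn theta s i).
Proof.
have := direction_mod i.+1; rewrite nordS nord_ord => -[<- <-].
by rewrite directionS nord_ord.
Qed.

Lemma directionD_le k m : psi k <= psi (k + m).
Proof.
elim: m => [|m IH]; first by rewrite addn0.
rewrite addnS directionS (le_trans IH)// lerDl ltW//.
by case/andP: (turn_itv (nord n0 (k + m))).
Qed.

(** The line at distance arsinh (s i) from the point (1, 0, 0) with inward normal at angle psi i.
    Next come the foot of the perpendicular from that point and the unit tangent there. *)
Definition std_normal i : 'rV[R]_3 :=
  vec3 (- s i) (vcosh (s i) * cos (psi i)) (vcosh (s i) * sin (psi i)).

Definition std_foot i : 'rV[R]_3 :=
  vec3 (vcosh (s i)) (- (s i * cos (psi i))) (- (s i * sin (psi i))).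

Definition std_tan i : 'rV[R]_3 := vec3 0 (sin (psi i)) (- cos (psi i)).

Definition std_vertex i : 'rV[R]_3 :=
  cosh (foot_start theta s i) *: std_foot i -
  sinh (foot_start theta s i) *: std_tan i.

Lemma mdot_vec3 (a b c a' b' c' : R) :
  mdot (vec3 a b c) (vec3 a' b' c') = - (a * a') + b * b' + c * c'.
Proof. by rewrite /mdot !vec3E0 !vec3E1 !vec3E2. Qed.

Lemma std_frame i : [/\ mdot (std_foot i) (std_foot i) = - 1,
  mdot (std_tan i) (std_tan i) = 1, mdot (std_normal i) (std_normal i) = 1 &
  [/\ mdot (std_foot i) (std_tan i) = 0, mdot (std_foot i) (std_normal i) = 0 &
      mdot (std_tan i) (std_normal i) = 0]].
Proof.
have cs := cos2sin2 (psi i); have hc := vcosh_sqr (s i).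
by split; [| | |split]; rewrite mdot_vec3; ring: cs hc.
Qed.

Let origin_proof : (mdot (vec3 1 0 0 : 'rV[R]_3) (vec3 1 0 0) == - 1) &&
  (0 < (vec3 1 0 0 : 'rV[R]_3) 0 0).
Proof. by rewrite mdot_vec3 vec3E0 ltr01 andbT; apply/eqP; ring. Qed.

Definition origin : H2 R := MkH2 origin_proof.

Lemma std_vertex_proof i :
  (mdot (std_vertex i) (std_vertex i) == - 1) && (0 < std_vertex i 0 0).
Proof.
have [FF TT _ [FT _ _]] := std_frame i.
have vv : mdot (std_vertex i) (std_vertex i) = - 1.
  rewrite /std_vertex -scaleNr; move: (std_foot i) (std_tan i) FF TT FT => F T FF TT FT.
  rewrite !mdotE FF TT (mdotC T F) FT.
  by have := cosh2_sinh2 (foot_start theta s i); lra.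
apply: (H2_sheet (x := origin)) => //.
rewrite /std_vertex /= /mdot !mxE /=.
by have := mulr_gt0 (cosh_gt0 (foot_start theta s i)) (vcosh_gt0 (s i)); lra.
Qed.

Definition std i : H2 R := MkH2 (std_vertex_proof i).

(** The polygon closes up: a vertex found by going back from the foot on edge i+1 is also reached by
    going forward from the foot on edge i. At the wrap-around this uses the total angle 2 pi,
    through [direction_ordS]. *)
Lemma std_end i : hpt (std (ordS i)) =
  cosh (foot_end theta s i) *: std_foot i + sinh (foot_end theta s i) *: std_tan i.
Proof.
rewrite /= /std_vertex foot_startS /foot_end.
have th := theta0 (ordS i).
have [e1 e2] := direction_ordS i.
rewrite /std_foot /std_tan e1 e2 cosD sinD /turn.
rewrite !(cosh_vfoot th) !sinh_vfoot (cos_vangle th) (sin_vangle th).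
rewrite /vcos (vdiscC (theta _) (s (ordS i))).
have st := lt0r_neq0 (sin_gt0_pi th).
have a0 := lt0r_neq0 (vcosh_gt0 (s i)); have b0 := lt0r_neq0 (vcosh_gt0 (s (ordS i))).
have ha := vcosh_sqr (s i); have hb := vcosh_sqr (s (ordS i)).
have hR := vdisc_sqr (theta (ordS i)) (s i) (s (ordS i)).
move: st a0 b0 ha hb hR.
move: (s i) (s (ordS i)) (cos (theta _)) (sin (theta _)) (cos (psi i)) (sin (psi i))
  (vcosh (s i)) (vcosh (s (ordS i))) (vdisc _ _ _).
move=> a b c sn cp sp ca cb r st a0 b0 ha hb hR.
apply: vec3_ext; rewrite !mxE /=.
- by field; rewrite st a0 b0.
- by field: ha hb hR; rewrite st a0 b0.
- by field: ha hb hR; rewrite st a0 b0.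
Qed.

Lemma mdot_origin_normal i : mdot origin (std_normal i) = s i.
Proof. by rewrite mdot_vec3; ring. Qed.

Lemma mdot_normals i :
  mdot (std_normal i) (std_normal (ordS i)) = - cos (theta (ordS i)).
Proof.
have th := theta0 (ordS i).
have [e1 e2] := direction_ordS i.
have -> : mdot (std_normal i) (std_normal (ordS i)) =
    - (s i * s (ordS i)) + vcosh (s i) * vcosh (s (ordS i)) * cos (turn theta s i).
  rewrite mdot_vec3 e1 e2 cosD sinD.
  by have cs := cos2sin2 (psi i); ring: cs.
rewrite /turn (cos_vangle th) /vcos.
by field; rewrite !lt0r_neq0// vcosh_gt0.
Qed.

Lemma foot_start_gt0 i : 0 < foot_start theta s i.
Proof.
apply/asinh_gt0/divr_gt0; last by rewrite mulr_gt0 ?vcosh_gt0// sin_gt0_pi.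
by have := mulr_ge0 (ltW (s0 i)) (cost i); have := s0 (ord_pred i); lra.
Qed.

Lemma foot_end_gt0 i : 0 < foot_end theta s i.
Proof.
apply/asinh_gt0/divr_gt0; last by rewrite mulr_gt0 ?vcosh_gt0// sin_gt0_pi.
by have := mulr_ge0 (ltW (s0 i)) (cost (ordS i)); have := s0 (ordS i); lra.
Qed.

(* Pairing of normal i with the k-th vertex in the Klein model centred at the
   origin, where the vertices move along the edges with direction std_tan. *)
Definition klein i k : R := mdot (std (nord n0 k)) (std_normal i) /
  (cosh (foot_start theta s (nord n0 k)) * vcosh (s (nord n0 k))).

(** The Euclidean length of edge i in the Klein model. *)
Definition klein_length i : R :=
  (sinh (foot_start theta s i) / cosh (foot_start theta s i) +
   sinh (foot_end theta s i) / cosh (foot_end theta s i)) / vcosh (s i).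

Lemma klein_length_gt0 i : 0 < klein_length i.
Proof.
rewrite /klein_length divr_gt0 ?vcosh_gt0// addr_gt0// divr_gt0 ?cosh_gt0//;
apply/sinh_gt0; [exact: foot_start_gt0|exact: foot_end_gt0].
Qed.

Lemma kleinS i k : klein i k.+1 = klein i k +
  klein_length (nord n0 k) * vcosh (s i) * sin (psi k - psi i).
Proof.
have [hc hs] := direction_mod k.
rewrite /klein /klein_length nordS sinB hc hs; set j := nord n0 k.
have e : cosh (foot_start theta s (ordS j)) * vcosh (s (ordS j)) =
    cosh (foot_end theta s j) * vcosh (s j).
  by have /(congr1 (fun v : 'rV[R]_3 => v 0 0)) := std_end j; rewrite !mxE /=; lra.
rewrite e std_end /= /std_vertex !mdotE.
have -> : mdot (std_tan j) (std_normal i) =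
    vcosh (s i) * (sin (psi j) * cos (psi i) - cos (psi j) * sin (psi i)).
  by rewrite mdot_vec3; ring.
move: (mdot _ _) => f.
by field; rewrite !lt0r_neq0// ?vcosh_gt0// cosh_gt0.
Qed.

Lemma std_normal_end i : mdot (std (ordS i)) (std_normal i) = 0.
Proof.
have [_ _ _ [_ FN TN]] := std_frame i.
by rewrite std_end mdotDl !mdotZl FN TN; ring.
Qed.

Lemma std_normal_start i : mdot (std i) (std_normal i) = 0.
Proof.
have [_ _ _ [_ FN TN]] := std_frame i.
by rewrite /= /std_vertex mdotDl mdotNl !mdotZl FN TN; ring.
Qed.

(** By the sine in [kleinS], the heights of the vertices over edge i rise from 0 at vertex i+1 while
    the directions are within pi of direction i, then fall to 0 at vertex i+n. This is the rising
    half; [klein_backward] reads the falling half from its end. *)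
Lemma klein_forward i m : psi (i + m.+1) - psi i <= pi -> 0 < klein i (i + m.+2).
Proof.
have step k : 0 < psi k - psi i < pi -> 0 <= klein i k -> 0 < klein i k.+1.
  move=> hk kk; rewrite kleinS ltr_pwDr// mulr_gt0 ?sin_gt0_pi//.
  by rewrite mulr_gt0 ?klein_length_gt0 ?vcosh_gt0.
have step' k : 0 <= psi k - psi i <= pi -> 0 <= klein i k -> 0 <= klein i k.+1.
  move=> hk kk; rewrite kleinS addr_ge0// mulr_ge0 ?sin_ge0_pi//.
  by rewrite ltW// mulr_gt0 ?klein_length_gt0 ?vcosh_gt0.
have k1 : klein i (i + 1) = 0.
  by rewrite /klein addn1 nordS nord_ord std_normal_end mul0r.
elim: m => [_|m IH hm].
  rewrite addnS; apply: step; last by rewrite k1.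
  by rewrite addn1 directionS nord_ord addrAC subrr add0r turn_itv.
have h : psi (i + m.+1) - psi i <= pi.
  apply: le_trans hm; rewrite lerD2r.
  by rewrite (_ : (i + m.+2)%N = (i + m.+1 + 1)%N) ?directionD_le//; lia.
rewrite addnS kleinS ltr_pwDl ?IH// mulr_ge0 ?sin_ge0_pi//.
  by rewrite ltW// mulr_gt0 ?klein_length_gt0 ?vcosh_gt0.
by rewrite hm subr_ge0 directionD_le.
Qed.

Lemma klein_backward i m : (m < n)%N -> pi < psi (i + n - m.+1) - psi i ->
  0 < klein i (i + n - m.+1).
Proof.
have kn : klein i (i + n) = 0.
  by rewrite /klein nordDn nord_ord std_normal_start mul0r.
have step k : pi < psi k - psi i < 2 * pi -> 0 <= klein i k.+1 -> 0 < klein i k.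
  move=> hk; rewrite kleinS => kk.
  have : 0 < sin (psi k - psi i - pi) by apply: sin_gt0_pi; lra.
  rewrite -(subrK pi (psi k - psi i)) sinDpi in kk => sp.
  have := mulr_gt0 (mulr_gt0 (klein_length_gt0 (nord n0 k)) (vcosh_gt0 (s i))) sp.
  by lra.
have upper k : (k < i + n)%N -> psi k - psi i < 2 * pi.
  move=> kn'; rewrite ltrBlDl -directionDn.
  have -> : (i + n)%N = (k.+1 + (i + n - k.+1))%N by lia.
  apply: lt_le_trans (directionD_le _ _).
  by rewrite directionS ltrDl; case/andP: (turn_itv (nord n0 k)).
elim: m => [|m IH] mn hm.
  apply: step; first by rewrite hm upper//; lia.
  by rewrite (_ : (i + n - 1).+1 = (i + n)%N) ?kn//; lia.
apply: step; first by rewrite hm upper//; lia.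
rewrite (_ : (i + n - m.+2).+1 = (i + n - m.+1)%N); last by lia.
apply/ltW/IH; first by lia.
apply: lt_le_trans hm _; rewrite lerD2r.
by rewrite (_ : (i + n - m.+1)%N = (i + n - m.+2 + 1)%N) ?directionD_le//; lia.
Qed.

Lemma klein_gt0 i m : (m.+2 < n)%N -> 0 < klein i (i + m.+2).
Proof.
move=> mn; have [hm|hm] := leP (psi (i + m.+1) - psi i) pi.
  exact: klein_forward.
have e : (i + m.+2)%N = (i + n - (n - m.+3).+1)%N by lia.
rewrite e; apply: klein_backward; first by lia.
apply: lt_le_trans hm _; rewrite lerD2r -e.
by rewrite (_ : (i + m.+2)%N = (i + m.+1 + 1)%N) ?directionD_le//; lia.
Qed.

Lemma std_inward : inward_normals std std_normal.
Proof.
move=> i; split; [|exact: std_normal_start|exact: std_normal_end|].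
  by case: (std_frame i).
move=> j /andP[ji jSi].
have [m mn e] : exists2 m, (m.+2 < n)%N & nord n0 (i + m.+2) = j.
  have hj := ltn_ord j; have hi := ltn_ord i.
  have {}ji : (j : nat) <> i by move=> e; move/eqP: ji; apply; apply: ord_inj.
  have {}jSi : (j : nat) <> if i.+1 == n then 0%N else i.+1.
    by rewrite -ordSE => e; move/eqP: jSi; apply; apply: ord_inj.
  have [ij|ij] := leqP i.+2 j.
    exists (j - i.+2)%N; first by lia.
    by rewrite (_ : (i + (j - i.+2).+2)%N = j) ?nord_ord//; lia.
  exists (j + n - i.+2)%N; first by move: jSi; case: ifP => /eqP; lia.
  rewrite (_ : (i + (j + n - i.+2).+2)%N = (j + n)%N) ?nordDn ?nord_ord//.
  by move: jSi; case: ifP => /eqP; lia.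
have := klein_gt0 i mn; rewrite /klein e pmulr_lgt0// invr_gt0 mulr_gt0//.
  exact: cosh_gt0.
exact: vcosh_gt0.
Qed.

Lemma std_mdotS i : - mdot (std i) (std (ordS i)) = cosh (support_length theta s i).
Proof.
have [FF TT _ [FT _ _]] := std_frame i.
rewrite std_end /= /std_vertex -scaleNr.
move: (std_foot i) (std_tan i) FF TT FT => F T FF TT FT.
by rewrite !mdotE FF TT (mdotC T F) FT coshD; ring.
Qed.

Lemma std_neq i : std i <> std (ordS i).
Proof.
have l0 : 0 < support_length theta s i.
  by rewrite addr_gt0 ?foot_start_gt0 ?foot_end_gt0.
move=> e; have := std_mdotS i; rewrite -e mdot_H2 opprK => c1.
have := cosh2_sinh2 (support_length theta s i); rewrite -c1.
by have := exprn_gt0 2 (sinh_gt0 l0); lra.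
Qed.

Lemma std_convex : convex_polygon std.
Proof. exact: (inward_normals_convex n3 std_neq std_inward). Qed.

Lemma std_polygon : polygons_with_angles theta std.
Proof.
split; first exact: std_convex.
move=> i; rewrite -(ord_predK i); set j := ord_pred i.
have /andP[t1 t2] := theta0 (ordS j).
have /andP[a1 a2] := angle_itv n3 std_neq std_inward j.
apply: cos_inj; rewrite ?in_itv/= ?ltW//.
by rewrite (cos_angle_normals n3 std_neq std_inward) mdot_normals opprK.
Qed.

End Standard.

(** * Centres and inscribed circles *)

Section PointAndLine.
Variable R : realType.
Implicit Types (N u v : 'rV[R]_3) (z p q : H2 R).

Lemma spacelike_orth q u : mdot q u = 0 -> 0 <= mdot u u.
Proof.
have qq := mdot_H2 q; have q0 := H2_gt0 q; move: qq q0; rewrite /mdot.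
move: (hpt q 0 0) (hpt q 0 1) (hpt q 0 2) (u 0 0) (u 0 1) (u 0 2).
move=> q0 q1 q2 u0 u1 u2 qq q00 qu.
have e1 : q0 * u0 = q1 * u1 + q2 * u2 by lra.
rewrite -(pmulr_rge0 _ (mulr_gt0 q00 q00)).
have -> : q0 * q0 * (- (u0 * u0) + u1 * u1 + u2 * u2) =
  (u1 * u1 + u2 * u2) + (q1 * u2 - q2 * u1) ^+ 2.
  transitivity (q0 * q0 * (u1 * u1 + u2 * u2) - (q0 * u0) * (q0 * u0)); first by ring.
  by rewrite e1 (_ : q0 * q0 = 1 + q1 * q1 + q2 * q2); [ring|lra].
by rewrite addr_ge0 ?sqr_ge0// addr_ge0// -expr2 sqr_ge0.
Qed.

Lemma mdot_cauchy_schwarz q u v : mdot q u = 0 -> mdot q v = 0 -> 0 < mdot v v ->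
  mdot u v ^+ 2 <= mdot u u * mdot v v.
Proof.
move=> qu qv vv.
have := @spacelike_orth q (mdot v v *: u - mdot u v *: v).
rewrite !mdotE qu qv !mulr0 subr0 => /(_ erefl).
rewrite (mdotC v u); move: (mdot u u) (mdot u v) (mdot v v) vv => a b c c0.
move=> h; rewrite -subr_ge0 -(pmulr_rge0 _ c0); apply: le_trans h _.
by rewrite le_eqVlt; apply/orP; left; apply/eqP; ring.
Qed.

(** Among the points at a given distance from q, the pairing with N is smallest straight towards the
    line; by Cauchy-Schwarz in the tangent plane at q. *)
Lemma mdot_normal_ge q z N : mdot N N = 1 ->
  cosh (hdist q z) * mdot q N - sinh (hdist q z) * vcosh (mdot q N) <= mdot z N.
Proof.
move=> NN; have [<-|qz] := pselect (q = z).
  by rewrite (hdist_cosh (x := q) (t := 0)) ?mdot_H2 ?cosh0 ?opprK// sinh0; lra.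
rewrite (htan_end qz) mdotDl !mdotZl lerD2l -mulrN.
rewrite ler_pM2l ?sinh_hdist_gt0//.
set s := mdot q N; have c0 := vcosh_gt0 s; have c2 := vcosh_sqr s.
have nn : mdot (N + s *: hpt q) (N + s *: hpt q) = 1 + s ^+ 2.
  by rewrite !mdotE NN mdot_H2 (mdotC N q) -/s; ring.
have qn : mdot q (N + s *: hpt q) = 0 by rewrite !mdotE mdot_H2 -/s; ring.
have nn0 : 0 < mdot (N + s *: hpt q) (N + s *: hpt q).
  by rewrite nn; have := sqr_ge0 s; lra.
have := mdot_cauchy_schwarz (mdot_htan q z) qn nn0.
rewrite htan_norm// mul1r nn -c2 mdotDr mdotZr (mdotC (htan q z) q) mdot_htan.
rewrite mulr0 addr0.
by move: (mdot (htan q z) N) (vcosh s) c0 => a c c0; nra.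
Qed.

Definition foot_vec q N : 'rV[R]_3 :=
  (vcosh (mdot q N))^-1 *: (hpt q - mdot q N *: N).

Lemma foot_proof q N : mdot N N = 1 ->
  (mdot (foot_vec q N) (foot_vec q N) == - 1) && (0 < foot_vec q N 0 0).
Proof.
move=> NN; have c0 := vcosh_gt0 (mdot q N); have c2 := vcosh_sqr (mdot q N).
have cn := lt0r_neq0 c0.
apply: (H2_sheet (x := q)).
  rewrite /foot_vec !mdotE mdot_H2 NN (mdotC N q).
  by move: (mdot q N) (vcosh (mdot q N)) cn c2 => s c cn c2; field: c2; rewrite cn.
rewrite /foot_vec !mdotE mdot_H2 (mdotC N q) pmulr_rlt0 ?invr_gt0//.
by have := sqr_ge0 (mdot q N); nra.
Qed.

Definition foot q N (NN : mdot N N = 1) : H2 R := MkH2 (foot_proof q NN).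

Lemma footE q N (NN : mdot N N = 1) :
  hpt (foot q NN) = (vcosh (mdot q N))^-1 *: (hpt q - mdot q N *: N).
Proof. by []. Qed.

Lemma mdot_foot q N (NN : mdot N N = 1) z : mdot z N = 0 ->
  mdot q z = vcosh (mdot q N) * mdot (foot q NN) z.
Proof.
move=> zN; rewrite footE mdotZl mdotDl mdotNl mdotZl (mdotC N z) zN.
by field; rewrite lt0r_neq0// vcosh_gt0.
Qed.

Lemma foot_normal q N (NN : mdot N N = 1) : mdot (foot q NN) N = 0.
Proof. by rewrite footE !mdotE NN; ring. Qed.

Lemma mdot_q_foot q N (NN : mdot N N = 1) : mdot q (foot q NN) = - vcosh (mdot q N).
Proof. by rewrite (mdot_foot q NN) ?foot_normal// mdot_H2 mulrN1. Qed.

Lemma vcosh_ge1 (a : R) : 1 <= vcosh a.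
Proof.
have := vcosh_sqr a; have := vcosh_gt0 a; have := sqr_ge0 a.
by move: (vcosh a) => c; nra.
Qed.

Lemma hdist_foot q N (NN : mdot N N = 1) :
  hdist q (foot q NN) = arcosh (vcosh (mdot q N)).
Proof. by rewrite /hdist mdot_q_foot opprK. Qed.

Lemma hdist_foot_le q N (NN : mdot N N = 1) z : mdot z N = 0 ->
  hdist q (foot q NN) <= hdist q z.
Proof.
move=> zN; rewrite hdist_foot /hdist ler_arcosh ?vcosh_ge1//.
rewrite (mdot_foot q NN zN); have := mdot_H2_le (foot q NN) z.
have := vcosh_gt0 (mdot q N).
by move: (mdot (foot q NN) z) (vcosh (mdot q N)) => m c; nra.
Qed.

(** The point reflection w of z in the foot T lies on the same line and the same circle. Uniqueness
    gives w = z, hence z = T. *)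
Lemma circle_line_foot q (r : R) N (NN : mdot N N = 1) z : mdot z N = 0 ->
  hcircle q r `&` [set z : H2 R | mdot z N = 0] = [set z] ->
  cosh r = vcosh (mdot q N).
Proof.
move=> zN e; set c := vcosh (mdot q N); have c0 : 0 < c := vcosh_gt0 _.
have [qz _] : (hcircle q r `&` [set z : H2 R | mdot z N = 0]) z by rewrite e.
have := foot_normal q NN; have := mdot_foot q NN zN; have := mdot_q_foot q NN.
rewrite -/c; move: (foot q NN) => T qT qzT TN.
have TT := mdot_H2 T; have zz := mdot_H2 z.
pose w := - (2 * mdot T z) *: hpt T - hpt z.
have ww : mdot w w = - 1.
  by rewrite /w !mdotE TT zz (mdotC z T); ring.
have wT : mdot w q = mdot q z.
  by rewrite /w !mdotE (mdotC T q) (mdotC z q) qT qzT; ring.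
have wq0 : mdot w q < 0 by rewrite wT; have := mdot_H2_le q z; lra.
pose w' := MkH2 (H2_sheet ww wq0).
have ew : w' = z.
  have : (hcircle q r `&` [set z : H2 R | mdot z N = 0]) w'.
    split; last by rewrite /= /w !mdotE TN zN; ring.
    by rewrite /hcircle /= /hdist (mdotC q w') [mdot w' q]wT.
  by rewrite e.
have Tz : mdot T z = - 1.
  have /(congr1 (fun u : H2 R => mdot (hpt u) (hpt T))) := ew.
  rewrite /= /w !mdotE TT (mdotC z T) => h.
  have m1 := mdot_H2_le T z.
  have /(congr1 (fun u : H2 R => mdot (hpt u) (hpt z))) := ew.
  rewrite /= /w !mdotE zz => h2.
  by move: h2 m1; move: (mdot T z) => m; nra.
by have := cosh_hdist q z; rewrite [hdist q z]qz qzT Tz => ->; ring.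
Qed.

End PointAndLine.

Lemma finite_lower_bound (R : realType) (T : finType) (f : T -> R) :
  (forall i, 0 < f i) -> exists2 m, 0 < m & forall i, m < f i.
Proof.
move=> f0; pose S := \sum_i (f i)^-1.
have S0 : 0 <= S by apply: sumr_ge0 => i _; rewrite invr_ge0 ltW.
exists (S + 1)^-1; first by rewrite invr_gt0; lra.
move=> i; rewrite invf_plt ?posrE//; last by lra.
rewrite /S (bigD1 i)//=.
have : 0 <= \sum_(j | j != i) (f j)^-1 by apply: sumr_ge0 => j _; rewrite invr_ge0 ltW.
by lra.
Qed.

Section Centers.
Variables (R : realType) (n : nat) (theta : 'I_n -> R).
Hypothesis (n3 : (3 <= n)%N) (theta_bound : forall i, 0 < theta i <= pi / 2).
Variables (P : 'I_n -> H2 R) (N : 'I_n -> 'rV[R]_3).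
Hypothesis (cP : convex_polygon P) (aP : forall i, angle P i = theta i).
Hypothesis (PN : inward_normals P N).
Implicit Types (i : 'I_n) (q z : H2 R).

Let theta0 i : 0 < theta i < pi.
Proof. by have := theta_bound i; have := @pi_gt0 R; lra. Qed.

Let Pne i : P i <> P (ordS i). Proof. by case: cP. Qed.

Let NN i : mdot (N i) (N i) = 1. Proof. by case: (PN i). Qed.

Lemma edge_lineP i z : edge_line P i z <-> mdot z (N i) = 0.
Proof. by have [NNi xN yN _] := PN i; apply: hlineP. Qed.

Lemma edge_normal i z : edge P i z -> mdot z (N i) = 0.
Proof. by move=> [a [b [_ _ e]]]; apply/edge_lineP; exists a, b. Qed.

(** If q were on the line, the point at distance r / 2 from q in the direction - N i would be in the
    ball but outside the region. *)
Lemma interior_normal_gt0 q i : hinterior (region P) q -> 0 < mdot q (N i).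
Proof.
move=> [r r0 br].
have ge0 z : hdist q z < r -> 0 <= mdot z (N i).
  by move=> /br /(regionP n3 z cP PN); apply.
have := ge0 q; rewrite (hdist_cosh (t := 0)) ?mdot_H2 ?cosh0 ?opprK// => /(_ r0).
rewrite le_eqVlt => /orP[/eqP q0|//].
pose d := r / 2; have d0 : 0 < d by rewrite /d; lra.
pose v := cosh d *: hpt q - sinh d *: N i.
have vv : mdot v v = - 1.
  rewrite /v !mdotE mdot_H2 NN (mdotC (N i) q) -q0.
  by have := cosh2_sinh2 d; lra.
have vq : mdot v q = - cosh d.
  by rewrite /v !mdotE mdot_H2 (mdotC (N i) q) -q0; ring.
have vq0 : mdot v q < 0 by rewrite vq oppr_lt0 cosh_gt0.
have := ge0 (MkH2 (H2_sheet vv vq0)).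
rewrite (hdist_cosh (t := d)) ?(ltW d0)//=; last by rewrite mdotC vq opprK.
have dr : d < r by rewrite /d; lra.
move=> /(_ dr); rewrite /v !mdotE NN -q0.
by have := sinh_gt0 d0; lra.
Qed.

Section Inside.
Variable q : H2 R.
Hypothesis q0 : forall i, 0 < mdot q (N i).
Let s i := mdot q (N i).

Lemma positive_interior : hinterior (region P) q.
Proof.
(* With m as sinh of the radius, [sinh d * vcosh (s i) <= s i <= cosh d * s i] for d below the
   radius, as [mdot_normal_ge] needs. *)
have [m m0 ms] : exists2 m, 0 < m & forall i, m < s i / vcosh (s i).
  by apply: finite_lower_bound => i; apply: divr_gt0; [exact: q0|exact: vcosh_gt0].
exists (asinh m); first exact: asinh_gt0.
move=> z; rewrite /hball /= => zr.
apply/(regionP n3 z cP PN) => i; apply: le_trans (mdot_normal_ge q z (NN i)).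
rewrite -/(s i) subr_ge0.
have : sinh (hdist q z) * vcosh (s i) <= s i.
  rewrite -ler_pdivlMr ?vcosh_gt0// ltW// (lt_trans _ (ms i))//.
  by rewrite -[m]sinh_asinh ltr_sinh.
move/le_trans; apply; rewrite ler_peMl ?cosh_ge1//; exact: ltW (q0 i).
Qed.

(** Angles at most pi / 2 make both signed distances y and x from the foot to the endpoints
    positive. The foot is then the combination of the endpoints with weights sinh x / sinh l and
    sinh y / sinh l. *)
Lemma foot_in_edge i : edge P i (foot q (NN i)).
Proof.
have [_ xN yN _] := PN i.
have fr := start_frame Pne PN i.
pose y := foot_start theta s i; pose x := foot_end theta s i.
have lE : edge_length P i = y + x := edge_length_support n3 theta0 q cP aP PN i.
have x0 : 0 < x by apply: foot_end_gt0.
have y0 : 0 < y by apply: foot_start_gt0.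
have l0 : 0 < sinh (edge_length P i) by rewrite lE sinh_gt0// addr_gt0.
have c0 := vcosh_gt0 (s i).
exists (sinh x / sinh (edge_length P i)), (sinh y / sinh (edge_length P i)).
split; [by rewrite divr_ge0// ltW// sinh_gt0|by rewrite divr_ge0// ltW// sinh_gt0|].
rewrite (edge_end Pne) footE -/(s i) {1}(orthoframe_coord q fr).
rewrite (pointed_start n3 theta0 q cP aP PN) (pointed_start_tan n3 theta0 q cP aP PN).
rewrite -/(s i) -/s -/y.
have e : sinh x = sinh (edge_length P i) * cosh y - cosh (edge_length P i) * sinh y.
  rewrite -(_ : edge_length P i - y = x) ?sinhD ?coshN ?sinhN; first by ring.
  by rewrite lE; ring.
rewrite e; move: (etan P i) => E; apply/rowP => k; rewrite !mxE.
by field; rewrite !lt0r_neq0.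
Qed.

Lemma sinh_hdist_edge i : sinh (hdist_set (edge P i) q) = s i.
Proof.
have -> : hdist_set (edge P i) q = arcosh (vcosh (s i)).
  have lb : lbound [set hdist q z | z in edge P i] (arcosh (vcosh (s i))).
    move=> _ [z /edge_normal zN <-]; rewrite -(hdist_foot q (NN i)).
    exact: hdist_foot_le.
  have mem : [set hdist q z | z in edge P i] (arcosh (vcosh (s i))).
    by exists (foot q (NN i)); [exact: foot_in_edge|exact: hdist_foot].
  apply/eqP; rewrite eq_le; apply/andP; split.
    by apply: ge_inf => //; exists (arcosh (vcosh (s i))).
  by apply: lb_le_inf => //; exists (arcosh (vcosh (s i))).
rewrite sinh_arcosh ?vcosh_ge1// vcosh_sqr addrC addKr.
by rewrite sqrtr_sqr gtr0_norm//; exact: q0.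
Qed.

Lemma weighted_center_support (w : 'I_n -> R) (t : R) : (forall i, 0 < w i) ->
  (forall i, s i = t * w i) -> has_weighted_center w P.
Proof.
move=> w0 sw; exists q; first exact: positive_interior.
by move=> i j; rewrite !sinh_hdist_edge !sw; field; rewrite !lt0r_neq0.
Qed.

Lemma inscribed_circle_support (t : R) : (forall i, s i = t) -> has_inscribed_circle P.
Proof.
move=> st; have t0 : 0 < t by rewrite -(st (Ordinal (leq_trans (isT : 0 < 3)%N n3))) q0.
have ct : cosh (asinh t) = vcosh t by rewrite cosh_asinh.
have dist z : hdist q z = asinh t -> mdot q z = - vcosh t.
  by move=> e; rewrite -ct -e cosh_hdist opprK.
exists q, (asinh t); split; first exact: asinh_gt0.
  move=> z; rewrite /hcircle /= => zr; apply/(regionP n3 z cP PN) => i.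
  apply: le_trans (mdot_normal_ge q z (NN i)); rewrite zr ct sinh_asinh.
  by rewrite -/(s i) st mulrC subrr.
move=> i; exists (foot q (NN i)); split; first exact: foot_in_edge.
apply/seteqP; split => [z [zr /edge_lineP zN]|z /= ->].
  have := mdot_foot q (NN i) zN; rewrite (dist _ zr) -/(s i) st => e.
  apply/esym/mdot_H2_eq; apply: (mulfI (lt0r_neq0 (vcosh_gt0 t))).
  by rewrite -e mulrN1.
split; last by apply/edge_lineP; exact: foot_normal.
by apply: hdist_cosh; rewrite ?mdot_q_foot ?opprK -/(s i) ?st ?ct// ltW// asinh_gt0.
Qed.

End Inside.

Lemma weighted_center_ratio (w : 'I_n -> R) : (forall i, 0 < w i) ->
  has_weighted_center w P -> exists2 q : H2 R, forall i, 0 < mdot q (N i) &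
  exists t : R, forall i, mdot q (N i) = t * w i.
Proof.
move=> w0 [q qint e]; have q0 i := interior_normal_gt0 i qint.
exists q => //; pose i0 := Ordinal (leq_trans (isT : 0 < 3)%N n3).
exists ((w i0)^-1 * mdot q (N i0)) => i.
have := e i i0; rewrite !sinh_hdist_edge// => <-.
by field; rewrite lt0r_neq0.
Qed.

Lemma inscribed_circle_ratio : has_inscribed_circle P ->
  exists2 q : H2 R, forall i, 0 < mdot q (N i) &
  exists t : R, forall i, mdot q (N i) = t.
Proof.
move=> [q [r [r0 cr tg]]].
have sr := sinh_gt0 r0.
suff h i : mdot q (N i) = sinh r by exists q => [i|]; [rewrite h|exists (sinh r)].
have [z [/edge_normal zN ez]] := tg i.
have cE : cosh r = vcosh (mdot q (N i)).
  apply: (circle_line_foot (NN i) zN); rewrite -ez; congr (_ `&` _).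
  by apply/seteqP; split => z' /edge_lineP.
set s := mdot q (N i) in cE *.
have ss : s ^+ 2 = sinh r ^+ 2.
  by have := vcosh_sqr s; rewrite -cE; have := cosh2_sinh2 r; lra.
move/eqP: ss; rewrite eqf_sqr => /orP[/eqP//|/eqP sN].
have c0 := vcosh_gt0 s; have c2 := vcosh_sqr s.
(* The point of the circle straight outwards across edge i; for s = - sinh r it violates the
   inequality of the region. *)
pose v := cosh r *: hpt q - (sinh r / vcosh s) *: (N i + s *: hpt q).
have vv : mdot v v = - 1.
  rewrite /v !mdotE mdot_H2 NN (mdotC (N i) q) -/s.
  have := cosh2_sinh2 r; move: (cosh r) (sinh r) (vcosh s) c0 c2.
  move=> a b c c0 c2 ab.
  have {}ab : a ^+ 2 = 1 + b ^+ 2 by lra.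
  by field: ab c2; rewrite lt0r_neq0.
have vq : mdot v q = - cosh r.
  by rewrite /v !mdotE mdot_H2 (mdotC (N i) q) -/s; ring.
have vq0 : mdot v q < 0 by rewrite vq oppr_lt0 cosh_gt0.
have : region P (MkH2 (H2_sheet vv vq0)).
  apply: cr; rewrite /hcircle /=; apply: hdist_cosh; rewrite ?(ltW r0)//=.
  by rewrite mdotC vq opprK.
move/(regionP n3 _ cP PN)/(_ i); rewrite /= /v !mdotE NN -/s => h.
exfalso; move: h; have -> : sinh r / vcosh s * (1 + s * s) = sinh r * vcosh s.
  by rewrite -expr2 -c2; field; rewrite lt0r_neq0.
rewrite sN; have := mulr_gt0 sr (vcosh_gt0 (- sinh r)).
by have := mulr_gt0 sr (cosh_gt0 r); lra.
Qed.

End Centers.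

(** * Minkowski's inequality for Euclidean polygons *)

Section DiscreteMinkowski.
Variables (R : realType) (n : nat) (psi : nat -> R).
Hypothesis (psi_step : forall k, 0 < psi k.+1 - psi k < pi).
Hypothesis (psi_n : psi n = psi 0%N + 2 * pi).
Implicit Types (f g h : nat -> R) (k : nat).

Local Notation d k := (psi k.+1 - psi k).

(** For periodic f and g, twice the mixed area of the Euclidean polygons with normals at the angles
    psi and support numbers f and g. *)
Definition area f g : R := \sum_(k < n)
  (f k * g k.+1 + f k.+1 * g k -
    (f k * g k + f k.+1 * g k.+1) * cos (d k)) / sin (d k).

Lemma areaC f g : area f g = area g f.
Proof. by apply: eq_bigr => k _; congr (_ / _); ring. Qed.

Lemma areaDr f g h (r : R) : area f (fun k => g k - r * h k) = area f g - r * area f h.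
Proof.
rewrite /area mulr_sumr -sumrB; apply: eq_bigr => k _.
have s0 := sin_gt0_pi (psi_step k).
by field; rewrite lt0r_neq0.
Qed.

Lemma sum_telescope (u : nat -> R) : \sum_(k < n) (u k.+1 - u k) = u n - u 0%N.
Proof. by rewrite -(big_mkord xpredT (fun k => u k.+1 - u k)) telescope_sumr. Qed.

Let sin_d k : 0 < sin (d k). Proof. exact: sin_gt0_pi. Qed.

Section Cut.
Variable alpha : R.
Local Notation a k := (psi k - alpha).
Hypothesis sin_a : forall k, (k <= n)%N -> sin (a k) != 0.

(* When f lists the support numbers of a Euclidean polygon whose edges have
   normals at the angles psi, this is the coordinate of the vertex between the
   edges k and k.+1 along the direction alpha. *)
Definition cut_coord f k : R := (f k * sin (a k.+1) - f k.+1 * sin (a k)) / sin (d k).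
(** The increment of cot (psi - alpha) over step k. It is negative exactly when psi k and psi k.+1
    are on the same side of the cut. *)
Definition cut_weight k : R := - (sin (d k) / (sin (a k) * sin (a k.+1))).

Let sin_dE k : sin (d k) = sin (a k.+1) * cos (a k) - cos (a k.+1) * sin (a k).
Proof. by rewrite -sinB; congr sin; ring. Qed.

Let cos_dE k : cos (d k) = cos (a k.+1) * cos (a k) + sin (a k.+1) * sin (a k).
Proof. by rewrite -cosB; congr cos; ring. Qed.

Let sin_an : sin (a n) = sin (a 0%N).
Proof. by rewrite psi_n -[in LHS]sinB2pi; congr sin; ring. Qed.

Let cos_an : cos (a n) = cos (a 0%N).
Proof. by rewrite psi_n -[in LHS]cosB2pi; congr cos; ring. Qed.

(** The cut diagonalises the form: after adding the telescoping sum of f g cot (psi - alpha), every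
    summand is a product of coordinates. *)
Lemma area_cut f g : f n = f 0%N -> g n = g 0%N ->
  area f g = \sum_(k < n) cut_weight k * cut_coord f k * cut_coord g k.
Proof.
move=> fn gn.
pose u k := f k * g k * cos (a k) / sin (a k).
have : \sum_(k < n) (u k.+1 - u k) = 0.
  by rewrite sum_telescope /u fn gn sin_an cos_an subrr.
move/eqP; rewrite eq_sym -subr_eq0 sub0r oppr_eq0 => /eqP u0.
rewrite -[LHS]addr0 -[X in _ + X]u0 /area -big_split /=; apply: eq_bigr => k _.
have k1 := sin_a (ltn_ord k); have k0 := sin_a (ltnW (ltn_ord k)).
have s0 := lt0r_neq0 (sin_d k).
rewrite /u /cut_weight /cut_coord; move: s0; rewrite cos_dE sin_dE.
have ca := cos2sin2 (a k); have cb := cos2sin2 (a k.+1).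
move: k1 k0 ca cb.
move: (sin (a k)) (cos (a k)) (sin (a k.+1)) (cos (a k.+1)).
move=> sa cca sb ccb k1 k0 ca cb s0.
by field: ca cb; rewrite k0 k1 s0.
Qed.

Lemma cut_weight_coord0 g : g n = g 0%N ->
  \sum_(k < n) cut_weight k * cut_coord g k = 0.
Proof.
move=> gn; transitivity (\sum_(k < n) (g k.+1 / sin (a k.+1) - g k / sin (a k))).
  apply: eq_bigr => k _; rewrite /cut_weight /cut_coord.
  have k1 := sin_a (ltn_ord k); have k0 := sin_a (ltnW (ltn_ord k)).
  by field; rewrite k1 k0 lt0r_neq0.
by rewrite (sum_telescope (fun k => g k / sin (a k))) gn sin_an subrr.
Qed.

Lemma cut_weight0 : \sum_(k < n) cut_weight k = 0.
Proof.
transitivity (\sum_(k < n) (cos (a k.+1) / sin (a k.+1) - cos (a k) / sin (a k))).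
  apply: eq_bigr => k _; rewrite /cut_weight sin_dE.
  have k1 := sin_a (ltn_ord k); have k0 := sin_a (ltnW (ltn_ord k)).
  by field; rewrite k1 k0.
by rewrite (sum_telescope (fun k => cos (a k) / sin (a k))) sin_an cos_an subrr.
Qed.

(** A translation along alpha shifts all coordinates by a constant. It leaves the area alone because
    of the two vanishing sums above, so coordinate 0 may be normalised to 0. *)
Let delta f k := cut_coord f k - cut_coord f 0.

Lemma area_delta f g : f n = f 0%N -> g n = g 0%N ->
  area f g = \sum_(k < n) cut_weight k * delta f k * delta g k.
Proof.
move=> fn gn; rewrite area_cut// /delta.
transitivity (\sum_(k < n) (cut_weight k * cut_coord f k * cut_coord g k
   - cut_coord f 0 * (cut_weight k * cut_coord g k)
   - cut_coord g 0 * (cut_weight k * cut_coord f k)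
   + cut_coord f 0 * cut_coord g 0 * cut_weight k)); last first.
  by apply: eq_bigr => k _; ring.
rewrite big_split/= !sumrB -!mulr_sumr !cut_weight_coord0// cut_weight0.
by ring.
Qed.

Variable q : nat.
Hypothesis weight_lt0 : forall k, (k < n)%N -> k != 0%N -> k != q -> cut_weight k < 0.

(** Terms 0 and q, the only ones whose weight may be positive, vanish. If the remaining nonpositive
    terms sum to 0, all coordinates vanish, and f is in the kernel of the form. *)
Lemma delta_area_le0 f : f n = f 0%N -> delta f q = 0 ->
  area f f <= 0 /\ (area f f = 0 -> forall g, g n = g 0%N -> area f g = 0).
Proof.
move=> fn fq.
have term_le0 (k : 'I_n) : cut_weight k * delta f k * delta f k <= 0.
  rewrite -mulrA -expr2; have [->|k0] := eqVneq (k : nat) 0%N.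
    by rewrite /delta subrr expr0n mulr0.
  have [->|kq] := eqVneq (k : nat) q; first by rewrite fq expr0n mulr0.
  by rewrite mulr_le0_ge0 ?sqr_ge0// ltW// weight_lt0.
split; first by rewrite area_delta//; apply: sumr_le0.
rewrite area_delta// => /eqP; rewrite -oppr_eq0 -sumrN psumr_eq0; last first.
  by move=> k _; rewrite oppr_ge0.
move=> /allP f0 g gn; rewrite area_delta// big1// => k _.
have [->|k0] := eqVneq (k : nat) 0%N; first by rewrite /delta subrr mulr0 mul0r.
have [->|kq] := eqVneq (k : nat) q; first by rewrite fq mulr0 mul0r.
have := f0 k (mem_index_enum k); rewrite /= oppr_eq0 -mulrA -expr2 mulf_eq0.
by rewrite lt_eqF ?weight_lt0//= sqrf_eq0 => /eqP->; rewrite mulr0 mul0r.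
Qed.

(** Subtract the multiple r h that kills coordinate q. Since f and h are orthogonal, this adds r^2
    [area h h] >= 0 to [area f f], and the sum is still at most 0; equality forces r = 0. *)
Lemma cut_minkowski f h : f n = f 0%N -> h n = h 0%N -> 0 < area h h ->
  area f h = 0 ->
  area f f <= 0 /\ (area f f = 0 -> forall g, g n = g 0%N -> area f g = 0).
Proof.
move=> fn hn hh fh.
have dh : delta h q != 0.
  by apply/eqP => dh; have [] := delta_area_le0 hn dh; rewrite leNgt hh.
pose r := delta f q / delta h q; pose v k := f k - r * h k.
have vn : v n = v 0%N by rewrite /v fn hn.
have dv : delta v q = 0.
  transitivity (delta f q - r * delta h q); last by rewrite /r mulfVK ?subrr.
  rewrite /delta /cut_coord /v.
  by field; rewrite !lt0r_neq0.
have [v0 veq] := delta_area_le0 vn dv.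
have vvE : area v v = area f f + r ^+ 2 * area h h.
  rewrite {2}/v areaDr areaC /v areaDr fh (areaC _ h) areaDr (areaC h f) fh.
  by ring.
have r2 : 0 <= r ^+ 2 * area h h by rewrite mulr_ge0 ?sqr_ge0// ltW.
split; first by lra.
move=> ff g gn; have r0 : r = 0.
  have : r ^+ 2 * area h h = 0 by lra.
  by move/eqP; rewrite mulf_eq0 (gt_eqF hh) orbF sqrf_eq0 => /eqP.
have vf : v = f by apply/funext => k; rewrite /v r0 mul0r subr0.
by rewrite vf in veq; apply: veq.
Qed.

End Cut.

(* The cut is at an angle slightly past [psi 0], so that exactly two steps,
   numbers 0 and q, cross the line through the cut. *)
Lemma area_minkowski f h : f n = f 0%N -> h n = h 0%N -> 0 < area h h ->
  area f h = 0 ->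
  area f f <= 0 /\ (area f f = 0 -> forall g, g n = g 0%N -> area f g = 0).
Proof.
have pi0 := @pi_gt0 R.
have mono k m : psi k <= psi (k + m)%N.
  elim: m => [|m IH]; first by rewrite addn0.
  by rewrite addnS (le_trans IH)//; have := psi_step (k + m); lra.
have mono' k m : (k <= m)%N -> psi k <= psi m.
  by move=> km; rewrite -(subnKC km) mono.
have ex : exists m, pi < psi m - psi 0%N by exists n; rewrite psi_n; lra.
case: (ex_minnP ex) => m hm mmin.
have m2 : (2 <= m)%N.
  by case: m hm {mmin} => [|[|//]]; [|have := psi_step 0]; lra.
have mn : (m <= n)%N by apply: mmin; rewrite psi_n; lra.
have below k : (k < m)%N -> psi k - psi 0%N <= pi.
  by move=> km; rewrite leNgt; apply/negP => /mmin; rewrite leqNgt km.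
(* Then alpha is strictly between psi 0 and psi 1, and alpha + pi strictly between psi (m-1) and psi
   m. *)
pose e := Num.min (psi 1%N - psi 0%N) (psi m - psi 0%N - pi) / 2.
have [e0 e1 e2] : [/\ 0 < e, e < psi 1%N - psi 0%N & e < psi m - psi 0%N - pi].
  have := psi_step 0; rewrite /e.
  have [] := leP (psi 1%N - psi 0%N) (psi m - psi 0%N - pi);
  by split; lra.
pose alpha := psi 0%N + e.
have pos k : (1 <= k)%N -> (k < m)%N -> 0 < sin (psi k - alpha).
  move=> k1 km; apply: sin_gt0_pi; have := below _ km; have := mono' _ _ k1.
  by rewrite /alpha; lra.
have neg k : (m <= k)%N -> (k <= n)%N -> sin (psi k - alpha) < 0.
  move=> mk kn; rewrite -(subrK pi (psi k - alpha)) sinDpi oppr_lt0; apply: sin_gt0_pi.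
  by have := mono' _ _ mk; have := mono' _ _ kn; rewrite psi_n /alpha; lra.
have neg0 : sin (psi 0%N - alpha) < 0.
  rewrite (_ : psi 0%N - alpha = - e) ?sinN ?oppr_lt0; last by rewrite /alpha; ring.
  by apply: sin_gt0_pi; have := psi_step 0; lra.
apply: (@cut_minkowski alpha _ m.-1).
- case=> [|k] kn; first exact: ltr0_neq0.
  by have [km|km] := ltnP k.+1 m; [apply/lt0r_neq0/pos|apply/ltr0_neq0/neg].
- move=> k kn k0 km; rewrite /cut_weight oppr_lt0 divr_gt0//.
  have [km'|mk] := ltnP k m.
    by rewrite mulr_gt0// pos//; lia.
  by rewrite nmulr_rgt0 neg//; lia.
Qed.

End DiscreteMinkowski.

(** * Derivatives of the support data *)

Section Jets.
Variable R : realType.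
Implicit Types (a b u v f g : R -> R) (x : R).

(* Caratheodory form of: the partial derivatives of u with respect to a and b
   at x are A0 and B0. *)
Definition jet x a b u (A0 B0 : R) : Prop := exists A B : R -> R,
  [/\ forall z, u z - u x = A z * (a z - a x) + B z * (b z - b x),
      {for x, continuous A}, {for x, continuous B}, A x = A0 & B x = B0].

Section Rules.
Variables (x : R) (a b : R -> R).
Hypothesis (ca : {for x, continuous a}) (cb : {for x, continuous b}).

Lemma jet_continuous u A0 B0 : jet x a b u A0 B0 -> {for x, continuous u}.
Proof.
move=> [A [B [uE cA cB _ _]]].
have -> : u = fun z => u x + (A z * (a z - a x) + B z * (b z - b x)).
  by apply/funext => z; rewrite -uE; ring.
apply: cvgD; first exact: cvg_cst.
by apply: cvgD; apply: cvgM => //; apply: cvgB => //; exact: cvg_cst.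
Qed.

Lemma jet_fst : jet x a b a 1 0.
Proof.
by exists (cst 1), (cst 0); split=> //;
  [move=> z; rewrite /cst; ring|exact: cst_continuous|exact: cst_continuous].
Qed.

Lemma jet_snd : jet x a b b 0 1.
Proof.
by exists (cst 0), (cst 1); split=> //;
  [move=> z; rewrite /cst; ring|exact: cst_continuous|exact: cst_continuous].
Qed.

Lemma jet_cst (c : R) : jet x a b (cst c) 0 0.
Proof.
by exists (cst 0), (cst 0); split=> //;
  [move=> z; rewrite /cst; ring|exact: cst_continuous|exact: cst_continuous].
Qed.

Lemma jetD u v A B C D : jet x a b u A B -> jet x a b v C D ->
  jet x a b (fun z => u z + v z) (A + C) (B + D).
Proof.
move=> [A1 [B1 [uE cA cB <- <-]]] [C1 [D1 [vE cC cD <- <-]]].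
exists (fun z => A1 z + C1 z), (fun z => B1 z + D1 z); split=> //.
- by move=> z; rewrite opprD addrACA uE vE; ring.
- exact: cvgD.
- exact: cvgD.
Qed.

Lemma jetM u v A B C D : jet x a b u A B -> jet x a b v C D ->
  jet x a b (fun z => u z * v z) (u x * C + v x * A) (u x * D + v x * B).
Proof.
move=> ju; have cu := jet_continuous ju.
case: ju => [A1 [B1 [uE cA cB <- <-]]] [C1 [D1 [vE cC cD <- <-]]].
exists (fun z => u z * C1 z + v x * A1 z), (fun z => u z * D1 z + v x * B1 z).
split=> //.
- move=> z; transitivity (u z * (v z - v x) + v x * (u z - u x)); first by ring.
  by rewrite uE vE; ring.
- by apply: cvgD; apply: cvgM => //; exact: cvg_cst.
- by apply: cvgD; apply: cvgM => //; exact: cvg_cst.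
Qed.

Lemma jet_comp f (d : R) u A B : is_derive (u x) 1 f d -> jet x a b u A B ->
  jet x a b (fun z => f (u z)) (d * A) (d * B).
Proof.
move=> /is_derive1_caratheodory[g [fE cg <-]] ju; have cu := jet_continuous ju.
case: ju => [A1 [B1 [uE cA cB <- <-]]].
have cgu : {for x, continuous (g \o u)} by exact: continuous_comp.
exists (fun z => g (u z) * A1 z), (fun z => g (u z) * B1 z); split=> //.
- by move=> z; rewrite fE uE; ring.
- exact: (cvgM cgu cA).
- exact: (cvgM cgu cB).
Qed.

Lemma jet_eq u A B C D : jet x a b u A B -> A = C -> B = D -> jet x a b u C D.
Proof. by move=> ju <- <-. Qed.

End Rules.

Lemma jet_trans x a b p q u A B C D E F :
  jet x a b u A B -> jet x p q a C D -> jet x p q b E F ->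
  jet x p q u (A * C + B * E) (A * D + B * F).
Proof.
move=> [A1 [B1 [uE cA cB <- <-]]] [C1 [D1 [aE cC cD <- <-]]] [E1 [F1 [bE cE cF <- <-]]].
exists (fun z => A1 z * C1 z + B1 z * E1 z), (fun z => A1 z * D1 z + B1 z * F1 z).
split=> //.
- by move=> z; rewrite uE aE bE; ring.
- by apply: cvgD; apply: cvgM.
- by apply: cvgD; apply: cvgM.
Qed.

Lemma jet_is_derive x a b u A B (a' b' : R) : jet x a b u A B ->
  is_derive x 1 a a' -> is_derive x 1 b b' -> is_derive x 1 u (A * a' + B * b').
Proof.
move=> [A1 [B1 [uE cA cB <- <-]]].
move=> /is_derive1_caratheodory[g [aE cg <-]] /is_derive1_caratheodory[h [bE ch <-]].
apply/is_derive1_caratheodory; exists (fun z => A1 z * g z + B1 z * h z); split=> //.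
  by move=> z; rewrite uE aE bE; ring.
by apply: cvgD; apply: cvgM.
Qed.

Lemma jet_sum (I : Type) (r : seq I) x a b (u : I -> R -> R) (A B : I -> R) :
  (forall i, jet x a b (u i) (A i) (B i)) ->
  jet x a b (fun z => \sum_(i <- r) u i z) (\sum_(i <- r) A i) (\sum_(i <- r) B i).
Proof.
move=> ju; elim: r => [|i r IH].
  have := jet_cst x a b 0; rewrite !big_nil; congr jet.
  by apply/funext => z; rewrite big_nil.
have := jetD (ju i) IH; rewrite !big_cons; congr jet.
by apply/funext => z; rewrite big_cons.
Qed.

(** Where u z = u x, the jet reads A z (z - x) + B z (m z - m x) = 0, so - A / B is a slope function
    for m, continuous at x. *)
Lemma jet_implicit x m u A B : {for x, continuous m} -> jet x id m u A B ->
  B != 0 -> (\forall z \near x, u z = u x) -> is_derive x 1 m (- (A / B)).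
Proof.
move=> cm [A1 [B1 [uE cA cB <- <-]]] B0 unear.
(* The slope identity is required at every z; where the equation cannot be solved, G is the plain
   difference quotient. *)
pose G z := if B1 z == 0 then (m z - m x) / (z - x) else
  if u z == u x then - (A1 z / B1 z) else (m z - m x) / (z - x).
have Gx : G x = - (A1 x / B1 x) by rewrite /G (negPf B0) eqxx.
apply/is_derive1_caratheodory; exists G.
have Bn : \forall z \near x, B1 z != 0.
  apply: (cB [set y : R | y != 0]); apply: open_nbhs_nbhs.
  by split=> //; exact: open_neq.
split; last exact: Gx.
- move=> z; rewrite /G; have h : m z - m x = (m z - m x) / (z - x) * (z - x).
    have [->|zx] := eqVneq z x; first by rewrite !subrr mulr0.
    by rewrite divfK// subr_eq0.
  case: ifP => [_|/negbT Bz]; first exact: h.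
  case: ifP => [/eqP uz|_]; last exact: h.
  have := uE z; rewrite uz subrr /= => e.
  by apply: (mulfI Bz); rewrite -[RHS]addr0 e; field.
- have cAB : (fun z => - (A1 z / B1 z)) @ x --> - (A1 x / B1 x).
    by apply: cvgN; apply: cvgM => //; apply: cvgV.
  have : G @ x --> G x; last by [].
  rewrite Gx; apply: cvg_trans cAB; apply: near_eq_cvg.
  near=> z; rewrite /G; have -> : B1 z == 0 = false by apply/negbTE; near: z.
  by have -> : u z == u x by apply/eqP; near: z.
Unshelve. all: by end_near. Qed.

End Jets.

Section VertexDerivatives.
Variable R : realType.
Implicit Types (a b : R -> R) (x t : R).

Lemma is_derive_vcosh x : is_derive x 1 (@vcosh R) (x / vcosh x).
Proof.
have h : 0 < 1 + x ^+ 2 by have := sqr_ge0 x; lra.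
have d1 : is_derive x 1 (fun y : R => 1 + y ^+ 2) (2 * x).
  by apply: is_derive_eq; rewrite add0r /GRing.scale /=; ring.
have d2 := @is_derive1_comp _ Num.sqrt _ x _ _ (is_derive1_sqrt h) d1.
apply: (is_derive_eq d2); rewrite -/(vcosh x).
by field; rewrite lt0r_neq0// vcosh_gt0.
Qed.

Lemma is_derive_vcoshV x (c : R) : c != 0 ->
  is_derive x 1 (fun y => (c * vcosh y)^-1) (- (x / (c * vcosh x ^+ 3))).
Proof.
move=> c0; have v0 := lt0r_neq0 (vcosh_gt0 x).
have d1 : is_derive x 1 (fun y => c * vcosh y) (c * (x / vcosh x)).
  by have := is_deriveZ c (is_derive_vcosh x).
have n0 : c * vcosh x != 0 by rewrite mulf_neq0.
apply: (is_derive_eq (@is_deriveV R (fun y => c * vcosh y) x _ 1 n0 d1)).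
rewrite /GRing.scale /=.
by field; rewrite v0.
Qed.

Section Curves.
Variables (t x : R) (a b : R -> R).
Hypothesis (t0 : 0 < t < pi).
Hypothesis (ca : {for x, continuous a}) (cb : {for x, continuous b}).

(** The derivative in b, 1 / [vdisc], is symmetric in a and b: this is the symmetry of the matrix of
    length derivatives. *)
Lemma jet_vfoot : jet x a b (fun z => vfoot t (a z) (b z))
  ((cos t - a x * b x) / (vdisc t (a x) (b x) * vcosh (a x) ^+ 2))
  (vdisc t (a x) (b x))^-1.
Proof.
have st := lt0r_neq0 (sin_gt0_pi t0).
have va := vcosh_gt0 (a x); have rr := vdisc_gt0 t0 (a x) (b x).
have jc := jetM ca cb (jet_fst x a b) (jet_cst x a b (cos t)).
have jn := jetD (jet_snd x a b) jc.
have jd := jet_comp ca cb (is_derive_vcoshV (a x) st) (jet_fst x a b).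
have jq := jetM ca cb jn jd.
have ja := jet_comp ca cb (is_derive_asinh _) jq.
have sE : Num.sqrt (1 + ((b x + a x * cos t) / (sin t * vcosh (a x))) ^+ 2) =
    vdisc t (a x) (b x) / (sin t * vcosh (a x)).
  by rewrite -(cosh_vfoot t0) cosh_asinh.
have ha := vcosh_sqr (a x).
apply: (jet_eq ja); rewrite /cst /= sE.
  have -> : vcosh (a x) ^+ 3 = vcosh (a x) * (1 + a x ^+ 2) by rewrite exprS ha.
  rewrite ha; have h : 1 + a x ^+ 2 != 0 by rewrite -ha expf_neq0// lt0r_neq0.
  by field; rewrite st h !lt0r_neq0.
by field; rewrite st !lt0r_neq0.
Qed.

Lemma jet_vangle : jet x a b (fun z => vangle t (a z) (b z))
  (- ((b x + a x * cos t) / (vdisc t (a x) (b x) * vcosh (a x) ^+ 2)))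
  (- ((a x + b x * cos t) / (vdisc t (a x) (b x) * vcosh (b x) ^+ 2))).
Proof.
have va := vcosh_gt0 (a x); have vb := vcosh_gt0 (b x).
have rr := vdisc_gt0 t0 (a x) (b x).
have jn := jetD (jetM ca cb (jet_fst x a b) (jet_snd x a b)) (jet_cst x a b (- cos t)).
have j1 := jet_comp ca cb (is_derive_vcoshV (a x) (oner_neq0 R)) (jet_fst x a b).
have j2 := jet_comp ca cb (is_derive_vcoshV (b x) (oner_neq0 R)) (jet_snd x a b).
have jq := jetM ca cb jn (jetM ca cb j1 j2).
have uE : (fun z => (a z * b z + cst (- cos t) z) *
    ((1 * vcosh (a z))^-1 * (1 * vcosh (b z))^-1)) = fun z => vcos t (a z) (b z).
  by apply/funext => z; rewrite /vcos /cst !mul1r invfM.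
rewrite uE in jq.
have dacos : is_derive (vcos t (a x) (b x)) 1 (@acos R)
    (- (vdisc t (a x) (b x) / (vcosh (a x) * vcosh (b x)))^-1).
  have vi := vcos_itv t0 (a x) (b x); apply: (is_derive_eq (is_derive1_acos vi)).
  by have /andP[h1 h2] := vi; rewrite -sin_acos ?ltW// -/(vangle _ _ _) (sin_vangle t0).
have ja := jet_comp ca cb dacos jq.
have ha := vcosh_sqr (a x); have hb := vcosh_sqr (b x).
apply: (jet_eq ja); rewrite /cst /=.
  have -> : vcosh (a x) ^+ 3 = vcosh (a x) * (1 + a x ^+ 2) by rewrite exprS ha.
  rewrite ha; have h : 1 + a x ^+ 2 != 0 by rewrite -ha expf_neq0// lt0r_neq0.
  by field; rewrite h !lt0r_neq0.
have -> : vcosh (b x) ^+ 3 = vcosh (b x) * (1 + b x ^+ 2) by rewrite exprS hb.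
rewrite hb; have h : 1 + b x ^+ 2 != 0 by rewrite -hb expf_neq0// lt0r_neq0.
by field; rewrite h !lt0r_neq0.
Qed.

End Curves.

(** [1 < a * b] puts the angle below pi / 2, where sin is increasing; in sin^2 = vdisc^2 / ((1 +
    a^2) (1 + b^2)) the numerator is at most 2 (1 + a^2) + 2 (1 + b^2). *)
Lemma vangle_small t (a b e : R) : 0 < t <= pi / 2 -> 0 < e < pi / 2 ->
  0 < a -> 0 < b -> 1 < a * b ->
  2 / (1 + a ^+ 2) + 2 / (1 + b ^+ 2) < sin e ^+ 2 -> vangle t a b < e.
Proof.
move=> tb eb a0 b0 ab h.
have t0 : 0 < t < pi by have := @pi_gt0 R; lra.
have vi := vangle_itv t0 a b.
have a1 : 0 < 1 + a ^+ 2 by have := sqr_ge0 a; lra.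
have b1 : 0 < 1 + b ^+ 2 by have := sqr_ge0 b; lra.
have small : vangle t a b < pi / 2.
  have : 0 < cos (vangle t a b).
    rewrite (cos_vangle t0) divr_gt0//; last by rewrite mulr_gt0 ?vcosh_gt0.
    by have := cos_le1 t; lra.
  rewrite -(@cos_pihalf R) ltr_cos// in_itv/=; first lra.
  by have := @pi_gt0 R; lra.
have eq : sin (vangle t a b) ^+ 2 < sin e ^+ 2.
  apply: le_lt_trans h; rewrite (sin_vangle t0) expr_div_n exprMn !vcosh_sqr vdisc_sqr.
  rewrite ler_pdivrMr ?mulr_gt0//.
  have -> : (2 / (1 + a ^+ 2) + 2 / (1 + b ^+ 2)) * ((1 + a ^+ 2) * (1 + b ^+ 2)) =
      2 * (1 + b ^+ 2) + 2 * (1 + a ^+ 2) by field; rewrite !lt0r_neq0.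
  have : a * b * cos t <= a * b by rewrite ger_pMr ?mulr_gt0// cos_le1.
  by have := sqr_ge0 (cos t); have := sqr_ge0 (a - b); nra.
have s0 : 0 < sin (vangle t a b) by exact: sin_gt0_pi.
have se : 0 < sin e by apply: sin_gt0_pi; lra.
have : sin (vangle t a b) < sin e by rewrite -(@ltr_pXn2r _ 2)// ?nnegrE ltW.
by rewrite ltr_sin ?in_itv//=; lra.
Qed.

End VertexDerivatives.

(** * The total angle under scaling *)

Section Scaling.
Variables (R : realType) (n : nat) (theta : 'I_n -> R).
Hypothesis (n3 : (3 <= n)%N) (theta_bound : forall i, 0 < theta i <= pi / 2).
Hypothesis theta_sum : 2 * pi < \sum_(i < n) (pi - theta i).
Implicit Types (s w : 'I_n -> R) (i : 'I_n).

Let theta0 i : 0 < theta i < pi.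
Proof. by have := theta_bound i; have := @pi_gt0 R; lra. Qed.

Let cost i : 0 <= cos (theta i).
Proof. by apply: cos_ge0_pihalf; have := theta_bound i; have := @pi_gt0 R; lra. Qed.

(** Minus the derivative of [turn theta s i] in [s i]; [turn_slopeS] is the same for
    [s (ordS i)]. *)
Definition turn_slope s i : R :=
  (s (ordS i) + s i * cos (theta (ordS i))) /
  (vdisc (theta (ordS i)) (s i) (s (ordS i)) * vcosh (s i) ^+ 2).
Definition turn_slopeS s i : R :=
  (s i + s (ordS i) * cos (theta (ordS i))) /
  (vdisc (theta (ordS i)) (s i) (s (ordS i)) * vcosh (s (ordS i)) ^+ 2).

Lemma turn_slope_gt0 s i : (forall j, 0 < s j) -> 0 < turn_slope s i.
Proof.
move=> s0; rewrite divr_gt0// ?mulr_gt0 ?exprn_gt0 ?vcosh_gt0 ?vdisc_gt0//.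
by have := mulr_ge0 (ltW (s0 i)) (cost (ordS i)); have := s0 (ordS i); lra.
Qed.

Lemma turn_slopeS_gt0 s i : (forall j, 0 < s j) -> 0 < turn_slopeS s i.
Proof.
move=> s0; rewrite divr_gt0// ?mulr_gt0 ?exprn_gt0 ?vcosh_gt0 ?vdisc_gt0//.
by have := mulr_ge0 (ltW (s0 (ordS i))) (cost (ordS i)); have := s0 i; lra.
Qed.

Section Curve.
Variables (x : R) (c c' : R -> 'I_n -> R).
Hypothesis dc : forall i, is_derive x 1 (fun z => c z i) (c' x i).

Let cc i : {for x, continuous (fun z => c z i)}.
Proof. by apply/differentiable_continuous/derivable1_diffP; case: (dc i). Qed.

Lemma is_derive_total_angle : is_derive x 1 (fun z => total_angle theta (c z))
  (- \sum_i (turn_slope (c x) i * c' x i + turn_slopeS (c x) i * c' x (ordS i))).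
Proof.
have d i : is_derive x 1 (fun z => turn theta (c z) i)
    (- (turn_slope (c x) i * c' x i + turn_slopeS (c x) i * c' x (ordS i))).
  have j := jet_vangle (theta0 (ordS i)) (@cc i) (@cc (ordS i)).
  by apply: (is_derive_eq (jet_is_derive j (dc i) (dc (ordS i)))); rewrite opprD !mulNr.
have := is_derive_sum d; rewrite sumrN.
by congr is_derive; apply/funext => z; rewrite fct_sumE.
Qed.

End Curve.

Lemma total_angle_scale_lt w (t t' : R) : (forall i, 0 < w i) -> 0 <= t < t' ->
  total_angle theta (fun i => t' * w i) < total_angle theta (fun i => t * w i).
Proof.
move=> w0 /andP[t0 tt].
pose c (z : R) i := z * w i.
have dc (x : R) i : is_derive x 1 (fun z => c z i) (w i).
  by rewrite /c; apply: is_derive_eq; rewrite /GRing.scale /=; ring.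
have dF x := @is_derive_total_angle x c (fun _ => w) (dc x).
have cF : {within `[t, t'], continuous (fun z => total_angle theta (c z))}.
  apply: continuous_subspaceT => x.
  by apply/differentiable_continuous/derivable1_diffP; case: (dF x).
have [z] := MVT tt (fun x _ => dF x) cF.
rewrite in_itv/= => /andP[zt _] e.
rewrite -subr_lt0 [X in X < 0]e mulNr oppr_lt0 mulr_gt0 ?subr_gt0//.
have z0 : 0 < z by exact: le_lt_trans zt.
have cz j : 0 < c z j by rewrite /c mulr_gt0.
have n0 : (0 < n)%N by exact: leq_trans n3.
rewrite (bigD1 (Ordinal n0))//= ltr_pwDl ?sumr_ge0// => [|i _].
  by rewrite addr_gt0// mulr_gt0 ?turn_slope_gt0 ?turn_slopeS_gt0.
by rewrite ltW// addr_gt0// mulr_gt0 ?turn_slope_gt0 ?turn_slopeS_gt0.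
Qed.

Lemma total_angle0 : total_angle theta (fun=> 0) = \sum_(i < n) (pi - theta i).
Proof.
have -> : \sum_(i < n) (pi - theta i) = \sum_(i < n) (pi - theta (ordS i)).
  by rewrite (reindex_inj (can_inj (@ordSK n))).
apply: eq_bigr => i _; rewrite /turn /vangle /vcos /vcosh expr0n /= addr0 sqrtr1.
rewrite mulr0 sub0r mulr1 divr1 acosN ?cosK//.
  by rewrite in_itv/=; have := theta0 (ordS i); lra.
by rewrite cos_geN1 cos_le1.
Qed.

(** Intermediate value theorem on [0, T]: the total angle is above 2 pi at 0 by [total_angle0], and
    below it at T. *)
Lemma exists_scale w : (forall i, 0 < w i) ->
  exists2 t : R, 0 < t & total_angle theta (fun i => t * w i) = 2 * pi.
Proof.
move=> w0; have [m m0 mw] := finite_lower_bound w0.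
have pi0 := @pi_gt0 R.
have nR : (3 : R) <= n%:R by rewrite (ler_nat _ 3).
(* If all n turns are below pi / n, the total angle is at most pi. *)
pose e : R := pi / n%:R.
have e0 : 0 < e by rewrite divr_gt0//; lra.
have e1 : e < pi / 2 by rewrite /e ltr_pM2l// ltf_pV2 ?posrE; lra.
have se : 0 < sin e ^+ 2 by rewrite exprn_gt0// sin_gt0_pi//; lra.
(* K > 4 / sin^2 e gives 2 / (1 + z^2) < sin^2 e / 2 for z > K, and K > 1 makes products of such z
   exceed 1, as [vangle_small] asks. *)
pose K := 2 + 4 / sin e ^+ 2.
have K4 : 4 / sin e ^+ 2 < K by rewrite /K; lra.
have K1 : 1 < K by have := divr_gt0 (ltr0n R 4 : 0 < 4) se; rewrite /K; lra.
pose T := K / m.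
have T0 : 0 < T by rewrite divr_gt0//; lra.
have Tw i : K < T * w i by rewrite /T mulrAC ltr_pdivlMr// ltr_pM2l//; lra.
have FT : total_angle theta (fun i => T * w i) < 2 * pi.
  have lt_e i : turn theta (fun i => T * w i) i < e.
    have t1 := Tw i; have t2 := Tw (ordS i).
    apply: vangle_small; [exact: theta_bound|by rewrite e0|lra|lra|by nra|].
    have h (z : R) : K < z -> 2 / (1 + z ^+ 2) < sin e ^+ 2 / 2.
      move=> Kz; have z2 : 0 < 1 + z ^+ 2 by have := sqr_ge0 z; lra.
      rewrite ltr_pdivrMr//.
      have h4 : 4 < K * sin e ^+ 2 by rewrite -ltr_pdivrMr.
      have h5 : K < z ^+ 2 by nra.
      have h6 : K * sin e ^+ 2 < z ^+ 2 * sin e ^+ 2 by rewrite ltr_pM2r.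
      by lra.
    by have := h _ t1; have := h _ t2; lra.
  apply: (@le_lt_trans _ _ (\sum_(i < n) e)).
    by apply: ler_sum => i _; apply: ltW.
  rewrite sumr_const card_ord /e -(mulr_natr (pi / n%:R)) divfK ?pnatr_eq0; first lra.
  by rewrite -lt0n (leq_trans _ n3).
pose F z := total_angle theta (fun i => z * w i).
have dF (x : R) : derivable F x 1.
  have dc i : is_derive x 1 (fun z : R => z * w i) (w i).
    by apply: is_derive_eq; rewrite /GRing.scale /=; ring.
  by case: (@is_derive_total_angle x (fun z i => z * w i) (fun _ => w) dc).
have cF : {within `[0, T], continuous F}.
  by apply: continuous_subspaceT => x; apply/differentiable_continuous/derivable1_diffP.
have F0 : F 0 = \sum_(i < n) (pi - theta i).
  rewrite -total_angle0; congr total_angle; apply/funext => i.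
  by rewrite mul0r.
have [|t tT Ft] := IVT (ltW T0) cF (v := 2 * pi).
  by rewrite F0 ge_min le_max (ltW FT) (ltW theta_sum) orbT.
exists t => //; move: tT; rewrite in_itv/= => /andP[t0 _].
rewrite lt_neqAle t0 andbT; apply/eqP => e00.
by move: theta_sum; rewrite -F0 e00 Ft ltxx.
Qed.

Lemma scale_unique w (t t' : R) : (forall i, 0 < w i) -> 0 < t -> 0 < t' ->
  total_angle theta (fun i => t * w i) = 2 * pi ->
  total_angle theta (fun i => t' * w i) = 2 * pi -> t = t'.
Proof.
move=> w0 t0 t0' e e'; have [h|h|//] := ltgtP t t'.
  by have := @total_angle_scale_lt w t t' w0; rewrite e e' ltxx h ltW// => /(_ isT).
by have := @total_angle_scale_lt w t' t w0; rewrite e e' ltxx h ltW// => /(_ isT).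
Qed.

End Scaling.

(** * The quadratic form of the length derivatives *)

Section Form.
Variables (R : realType) (n : nat) (theta : 'I_n -> R).
Hypothesis (n3 : (3 <= n)%N) (theta_bound : forall i, 0 < theta i <= pi / 2).
Implicit Types (s f g u w : 'I_n -> R) (i : 'I_n).

Let theta0 i : 0 < theta i < pi.
Proof. by have := theta_bound i; have := @pi_gt0 R; lra. Qed.

Let n0 : (0 < n)%N. Proof. exact: leq_trans n3. Qed.

Let cost i : 0 <= cos (theta i).
Proof. by apply: cos_ge0_pihalf; have := theta_bound i; have := @pi_gt0 R; lra. Qed.

(* The symmetric matrix of partial derivatives of the edge lengths with respect
   to the support data s. *)
Definition length_form s f g : R := \sum_i
  (f i * g (ordS i) + f (ordS i) * g i + (cos (theta (ordS i)) - s i * s (ordS i)) *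
    (f i * g i / vcosh (s i) ^+ 2 +
     f (ordS i) * g (ordS i) / vcosh (s (ordS i)) ^+ 2)) /
  vdisc (theta (ordS i)) (s i) (s (ordS i)).

Lemma length_form_area s f g :
  length_form s f g = area n (direction theta n3 s)
    (fun k => f (nord n0 k) / vcosh (s (nord n0 k)))
    (fun k => g (nord n0 k) / vcosh (s (nord n0 k))).
Proof.
apply: eq_bigr => k _.
have -> : direction theta n3 s k.+1 - direction theta n3 s k = turn theta s k.
  by rewrite directionS addrC addKr nord_ord.
rewrite nordS !nord_ord.
rewrite /turn (cos_vangle (theta0 _)) (sin_vangle (theta0 _)) /vcos.
have v1 := vcosh_gt0 (s k); have v2 := vcosh_gt0 (s (ordS k)).
have rr := vdisc_gt0 (theta0 (ordS k)) (s k) (s (ordS k)).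
by field; rewrite !lt0r_neq0.
Qed.

(** Termwise: with p and q the ratios z^2 / (1 + z^2), which are below 1, the numerator is ab (2 - p
    - q) + cos theta (p + q). *)
Lemma length_form_gt0 s : (forall i, 0 < s i) -> 0 < length_form s s s.
Proof.
move=> s0; have term (i : 'I_n) : 0 < (s i * s (ordS i) + s (ordS i) * s i +
    (cos (theta (ordS i)) - s i * s (ordS i)) *
    (s i * s i / vcosh (s i) ^+ 2 +
     s (ordS i) * s (ordS i) / vcosh (s (ordS i)) ^+ 2)) /
  vdisc (theta (ordS i)) (s i) (s (ordS i)).
  rewrite divr_gt0 ?vdisc_gt0// !vcosh_sqr.
  have ratio (z : R) : 0 <= z * z / (1 + z ^+ 2) < 1.
    have z2 : 0 < 1 + z ^+ 2 by have := sqr_ge0 z; lra.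
    by rewrite ltr_pdivrMr// divr_ge0 ?(ltW z2)//= -?expr2 ?sqr_ge0//; lra.
  have := ratio (s i); have := ratio (s (ordS i)).
  have ab := mulr_gt0 (s0 i) (s0 (ordS i)); have c0 := cost (ordS i).
  move: (_ / _) (_ / _) => p q.
  move: (s i * s (ordS i)) (s (ordS i) * s i) (mulrC (s i) (s (ordS i))) ab.
  move=> a b -> {}a0 /andP[q0 q1] /andP[p0 p1].
  by have := mulr_ge0 c0 (addr_ge0 p0 q0); nra.
rewrite /length_form (bigD1 (Ordinal n0))//= ltr_pwDl ?term//.
by apply: sumr_ge0 => i _; apply: ltW (term i).
Qed.

Lemma length_form_minkowski s u : (forall i, 0 < s i) -> total_angle theta s = 2 * pi ->
  length_form s s u = 0 ->
  length_form s u u <= 0 /\ (length_form s u u = 0 -> forall g, length_form s u g = 0).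
Proof.
move=> s0 stot su; have ss := length_form_gt0 s0.
rewrite !length_form_area in su ss *.
have per f : (fun k => f (nord n0 k) / vcosh (s (nord n0 k))) n =
   (fun k => f (nord n0 k) / vcosh (s (nord n0 k))) 0%N.
  by rewrite /= (nordDn _ 0 : nord _ n = _).
have step k : 0 < direction theta n3 s k.+1 - direction theta n3 s k < pi.
  by rewrite directionS addrAC subrr add0r; exact: turn_itv.
have last : direction theta n3 s n = direction theta n3 s 0%N + 2 * pi.
  by rewrite (direction_n n3 stot) direction0 add0r.
have [h1 h2] := area_minkowski step last (per u) (per s) ss (etrans (areaC _ _ _ _) su).
by split=> // e g; rewrite length_form_area; exact: h2.
Qed.

(** Row i of that matrix applied to u, that is, the derivative of the length of edge i in the
    direction u. *)
Definition length_slope s u i : R :=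
  (u (ordS i) + (cos (theta (ordS i)) - s i * s (ordS i)) * u i / vcosh (s i) ^+ 2) /
    vdisc (theta (ordS i)) (s i) (s (ordS i)) +
  (u (ord_pred i) + (cos (theta i) - s i * s (ord_pred i)) * u i / vcosh (s i) ^+ 2) /
    vdisc (theta i) (s i) (s (ord_pred i)).

Lemma sum_length_slope s g u : \sum_i g i * length_slope s u i = length_form s g u.
Proof.
rewrite /length_slope.
under eq_bigr do rewrite mulrDr.
rewrite big_split /= [X in _ + X](reindex_inj (can_inj (@ordSK n))) /= -big_split /=.
apply: eq_bigr => i _; rewrite ordSK (vdiscC _ (s (ordS i))).
have v1 := vcosh_gt0 (s i); have v2 := vcosh_gt0 (s (ordS i)).
have rr := vdisc_gt0 (theta0 (ordS i)) (s i) (s (ordS i)).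
by field; rewrite !lt0r_neq0.
Qed.

Lemma length_form_turn s u : length_form s s u =
  \sum_i (turn_slope theta s i * u i + turn_slopeS theta s i * u (ordS i)).
Proof.
apply: eq_bigr => i _; rewrite /turn_slope /turn_slopeS.
have ha := vcosh_sqr (s i); have hb := vcosh_sqr (s (ordS i)).
have v1 := lt0r_neq0 (vcosh_gt0 (s i)); have v2 := lt0r_neq0 (vcosh_gt0 (s (ordS i))).
have rr := lt0r_neq0 (vdisc_gt0 (theta0 (ordS i)) (s i) (s (ordS i))).
by field: ha hb; rewrite v1 v2 rr.
Qed.

Lemma length_formC s f g : length_form s f g = length_form s g f.
Proof. by rewrite !length_form_area areaC. Qed.

Lemma is_derive_support_length (x : R) (c : R -> 'I_n -> R) (u : 'I_n -> R) i :
  (forall i, is_derive x 1 (fun z => c z i) (u i)) ->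
  is_derive x 1 (fun z => support_length theta (c z) i) (length_slope (c x) u i).
Proof.
move=> dc; have cc j : {for x, continuous (fun z => c z j)}.
  by apply/differentiable_continuous/derivable1_diffP; case: (dc j).
have j1 := jet_is_derive (jet_vfoot (theta0 i) (cc i) (cc (ord_pred i)))
  (dc i) (dc (ord_pred i)).
have j2 := jet_is_derive (jet_vfoot (theta0 (ordS i)) (cc i) (cc (ordS i)))
  (dc i) (dc (ordS i)).
apply: (is_derive_eq (is_deriveD j1 j2)); rewrite /length_slope.
have v1 := vcosh_gt0 (c x i).
have r1 := vdisc_gt0 (theta0 (ordS i)) (c x i) (c x (ordS i)).
have r2 := vdisc_gt0 (theta0 i) (c x i) (c x (ord_pred i)).
by field; rewrite !lt0r_neq0.
Qed.

End Form.

(** * Deformation to the centred polygon *)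

Lemma near_cst_derive (R : realType) (f : R -> R) (x a c : R) :
  (\forall z \near x, f z = c) -> is_derive x 1 f a -> a = 0.
Proof.
move=> fc df; have dc : is_derive x 1 (cst c : R -> R) a.
  exact: near_eq_is_derive df.
by rewrite -(@derive_val _ _ _ _ _ _ _ dc) derive_cst.
Qed.

Section Path.
Variables (R : realType) (n : nat) (theta : 'I_n -> R).
Hypothesis (n3 : (3 <= n)%N) (theta_bound : forall i, 0 < theta i <= pi / 2).
Hypothesis theta_sum : 2 * pi < \sum_(i < n) (pi - theta i).
Variables (sigma w : 'I_n -> R).
Hypotheses (sigma0 : forall i, 0 < sigma i) (w0 : forall i, 0 < w i).
Hypotheses (sigma_tot : total_angle theta sigma = 2 * pi)
  (w_tot : total_angle theta w = 2 * pi).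
Implicit Types (i : 'I_n) (x z : R).

Let theta0 i : 0 < theta i < pi.
Proof. by have := theta_bound i; have := @pi_gt0 R; lra. Qed.

Let line z i : R := (1 - z) * sigma i + z * w i.

Let is_derive_line x i : is_derive x 1 (fun z => line z i) (w i - sigma i).
Proof. by rewrite /line; apply: is_derive_eq; rewrite /GRing.scale /=; ring. Qed.

(** The derivatives at the ends of the path are two-sided, so the segment has to stay positive
    slightly beyond [0, 1]. *)
Lemma line_margin : exists2 d : R, 0 < d &
  forall z, - d < z < 1 + d -> forall i, 0 < line z i.
Proof.
have [d d0 hd] : exists2 d, 0 < d &
    forall i, d < Num.min (sigma i / w i) (w i / sigma i).
  by apply: finite_lower_bound => i; rewrite lt_min !divr_gt0.
exists d => // z zd i; have := hd i; rewrite lt_min => /andP[].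
rewrite !ltr_pdivlMr// => h1 h2; rewrite /line.
have a0 := sigma0 i; have b0 := w0 i.
move: (sigma i) (w i) a0 b0 h1 h2 => a b a0 b0 h1 h2.
have [z0|z0] := ltP z 0; first by nra.
have [z1|z1] := ltP 1 z; first by nra.
have [->|zn] := eqVneq z 0; first by lra.
have : 0 < z * b by rewrite mulr_gt0// lt0r zn.
have : 0 <= (1 - z) * a by rewrite mulr_ge0 ?(ltW a0)//; lra.
by lra.
Qed.

Lemma path_scale : exists m : R -> R, forall z, (forall i, 0 < line z i) ->
  0 < m z /\ total_angle theta (fun i => m z * line z i) = 2 * pi.
Proof.
suff h : forall z, exists t, (forall i, 0 < line z i) ->
    0 < t /\ total_angle theta (fun i => t * line z i) = 2 * pi.
  by have [m hm] := choice h; exists m.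
move=> z.
(* Choice asks for a value at every z; where the segment is not positive it is a dummy 0. *)
have [pz|pz] := pselect (forall i, 0 < line z i); last by exists 0.
by have [t t0 e] := exists_scale n3 theta_bound theta_sum pz; exists t.
Qed.

Section Scale.
Variables (d : R) (m : R -> R).
Hypothesis (line0 : forall z, - d < z < 1 + d -> forall i, 0 < line z i).
Hypothesis (mP : forall z, (forall i, 0 < line z i) ->
  0 < m z /\ total_angle theta (fun i => m z * line z i) = 2 * pi).
Let c z i : R := m z * line z i.

Section Point.
Variable x : R.
Hypothesis xd : - d < x < 1 + d.

Let near_itv : \forall z \near x, - d < z < 1 + d.
Proof.
have xi : x \in `](- d), (1 + d)[ by rewrite in_itv.
by have := near_in_itvoo xi; apply: filterS => z; rewrite in_itv.
Qed.

Let m0 : 0 < m x. Proof. by have [] := mP (line0 xd). Qed.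

(** The total angle is above 2 pi at the scale m x - e1 and below at m x + e1. Both persist for z
    near x, and monotonicity in the scale traps m z in between. *)
Lemma scale_continuous : {for x, continuous m}.
Proof.
have cG k : {for x, continuous (fun z => total_angle theta (fun i => k * line z i))}.
  have dc i : is_derive x 1 (fun z => k * line z i) (k * (w i - sigma i)).
    by have := is_deriveZ k (is_derive_line x i).
  apply/differentiable_continuous/derivable1_diffP.
  by case: (@is_derive_total_angle _ _ _ theta_bound x (fun z i => k * line z i)
    (fun _ i => k * (w i - sigma i)) dc).
have [mx0 mx] := mP (line0 xd).
apply/cvgrPdist_lt => e e0.
pose e1 := Num.min e (m x) / 2.
have [e10 e1e e1m] : [/\ 0 < e1, e1 < e & e1 < m x].
  by rewrite /e1; case: (leP e (m x)) => h; split; lra.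
have GL : 2 * pi < total_angle theta (fun i => (m x - e1) * line x i).
  by rewrite -mx; apply: (total_angle_scale_lt n3 theta_bound (line0 xd)); lra.
have GU : total_angle theta (fun i => (m x + e1) * line x i) < 2 * pi.
  by rewrite -mx; apply: (total_angle_scale_lt n3 theta_bound (line0 xd)); lra.
near=> z.
have zd : - d < z < 1 + d by near: z.
have zL : 2 * pi < total_angle theta (fun i => (m x - e1) * line z i).
  by near: z; apply: cvgr_gt GL; exact: cG.
have zU : total_angle theta (fun i => (m x + e1) * line z i) < 2 * pi.
  by near: z; apply: cvgr_lt GU; exact: cG.
have [mz0 mz] := mP (line0 zd).
have lo : m x - e1 < m z.
  rewrite ltNge le_eqVlt; apply/negP => /orP[/eqP e'|lt].
    by move: zL; rewrite -e' mz ltxx.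
  have : 0 <= m z < m x - e1 by rewrite ltW.
  by move/(total_angle_scale_lt n3 theta_bound (line0 zd)); rewrite mz; lra.
have hi : m z < m x + e1.
  rewrite ltNge le_eqVlt; apply/negP => /orP[/eqP e'|lt].
    by move: zU; rewrite e' mz ltxx.
  have : 0 <= m x + e1 < m z by rewrite lt andbT; lra.
  by move/(total_angle_scale_lt n3 theta_bound (line0 zd)); rewrite mz; lra.
by rewrite ltr_norml; lra.
Unshelve. all: by end_near. Qed.

Lemma scale_derivable : exists m', is_derive x 1 m m'.
Proof.
have cm := scale_continuous.
have ci : {for x, continuous (id : R -> R)} by exact: cvg_id.
have jl i : jet x id m (fun z => line z i) (w i - sigma i) 0.
  exists (cst (w i - sigma i)), (cst 0); split=> //; try exact: cst_continuous.
  by move=> z; rewrite /cst /line /=; ring.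
have jc i : jet x id m (fun z => c z i) (m x * (w i - sigma i)) (line x i).
  by apply: (jet_eq (jetM ci cm (jet_snd x id m) (jl i))); ring.
have cc i : {for x, continuous (fun z => c z i)}.
  exact: (jet_continuous ci cm (jc i)).
have jt i := jet_trans (jet_vangle (theta0 (ordS i)) (cc i) (cc (ordS i)))
  (jc i) (jc (ordS i)).
have jtot := jet_sum (index_enum 'I_n) jt.
have cx0 i : 0 < c x i by rewrite mulr_gt0// line0.
eexists; apply: (jet_implicit cm jtot).
- apply/ltr0_neq0; rewrite -oppr_gt0 -sumrN.
  have term i : 0 < - (- turn_slope theta (c x) i * line x i +
      - turn_slopeS theta (c x) i * line x (ordS i)).
    rewrite opprD !mulNr !opprK addr_gt0// mulr_gt0 ?line0//.
      exact: turn_slope_gt0.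
    exact: turn_slopeS_gt0.
  have n0 : (0 < n)%N by exact: leq_trans n3.
  rewrite (bigD1 (Ordinal n0))//= ltr_pwDl//; first exact: (term (Ordinal n0)).
  by apply: sumr_ge0 => i _; apply: ltW (term i).
- near=> z.
  have zd : - d < z < 1 + d by near: z.
  have [_ ez] := mP (line0 zd); have [_ ex] := mP (line0 xd).
  by rewrite -[LHS]/(total_angle theta (c z)) -[RHS]/(total_angle theta (c x)) ez ex.
Unshelve. all: by end_near. Qed.

(** The segment heads for w: w = line x + (1 - x) (w - sigma). After rescaling by m, this puts w in
    the span of the current data c x and the velocity u. *)
Lemma path_derive : exists u : 'I_n -> R,
  [/\ forall i, is_derive x 1 (fun z => c z i) (u i),
      length_form theta (c x) (c x) u = 0 &
      exists al : R, forall i, w i = al * c x i + (1 - x) / m x * u i].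
Proof.
have [m' dm] := scale_derivable.
pose u i := m x * (w i - sigma i) + line x i * m'.
have dc i : is_derive x 1 (fun z => c z i) (u i).
  apply: (is_derive_eq (is_deriveM dm (is_derive_line x i))).
  by rewrite /u /GRing.scale.
exists u; split=> //.
  have dt := @is_derive_total_angle _ _ _ theta_bound x c (fun _ => u) dc.
  rewrite (length_form_turn theta_bound); apply: oppr_inj; rewrite oppr0.
  apply: (near_cst_derive _ dt (c := 2 * pi)); near=> z.
  have zd : - d < z < 1 + d by near: z.
  by have [] := mP (line0 zd).
exists ((m x)^-1 - (1 - x) * m' / m x ^+ 2) => i.
by rewrite /c /u /line; field; rewrite lt0r_neq0.
Unshelve. all: by end_near. Qed.

End Point.

Hypothesis d0 : 0 < d.

Let E z : R := \sum_i w i * support_length theta (c z) i.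

(** Insert the decomposition of w from [path_derive]: the component along c x drops out since the
    form pairs c x and u to 0, and the one along u leaves k = (1 - x) / m x times the form at u. *)
Lemma path_weighted_derive x : 0 <= x <= 1 -> exists u : 'I_n -> R,
  [/\ forall i, is_derive x 1 (fun z => support_length theta (c z) i)
        (length_slope theta (c x) u i),
      exists2 k : R, 0 <= k /\ (x < 1 -> 0 < k) &
        is_derive x 1 E (k * length_form theta (c x) u u),
      length_form theta (c x) u u <= 0 &
      length_form theta (c x) u u = 0 -> forall i, length_slope theta (c x) u i = 0].
Proof.
move=> x01; have xd : - d < x < 1 + d by move: d0; lra.
have [mx ctot] := mP (line0 xd).
have [u [du cu [al wE]]] := path_derive xd.
have c0 i : 0 < c x i by rewrite mulr_gt0// line0.
have dl i := is_derive_support_length theta_bound i du.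
have [uu0 uueq] := length_form_minkowski n3 theta_bound c0 ctot cu.
exists u; split=> //.
  exists ((1 - x) / m x).
    by split=> [|x1]; [apply: divr_ge0|apply: divr_gt0]; lra.
  have dE : is_derive x 1 E (\sum_i w i * length_slope theta (c x) u i).
    have := is_derive_sum (fun i => is_deriveZ (w i) (dl i)).
    by congr is_derive; apply/funext => z; rewrite fct_sumE.
  apply: (is_derive_eq dE).
  have e := sum_length_slope theta_bound (c x) (c x) u; rewrite cu in e.
  transitivity (al * (\sum_i c x i * length_slope theta (c x) u i) +
      (1 - x) / m x * (\sum_i u i * length_slope theta (c x) u i)); last first.
    by rewrite e mulr0 add0r (sum_length_slope theta_bound).
  rewrite !mulr_sumr -big_split /=.
  by apply: eq_bigr => i _; rewrite {1}wE; ring.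
(* Now u is in the kernel of the form; pairing it with the i-th basis vector extracts row i. *)
move=> /uueq h i; have := sum_length_slope theta_bound (c x) (fun j => (j == i)%:R) u.
rewrite (length_formC n3 theta_bound) h (bigD1 i)//= eqxx mul1r.
rewrite big1 ?addr0// => j /negPf->.
by rewrite mul0r.
Qed.

Let E_derivable x : 0 <= x <= 1 -> derivable E x 1.
Proof. by move=> /path_weighted_derive[u [_ [k _ []]]]. Qed.

Let E_nincr x y : 0 <= x -> x <= y -> y <= 1 -> E y <= E x.
Proof.
apply: ler0_derive1_nincr.
- by move=> z; rewrite in_itv/= => /andP[z0 z1]; apply: E_derivable; rewrite !ltW.
- move=> z; rewrite in_itv/= => /andP[z0 z1].
  have [|u [_ [k [k0 _] dE] uu _]] := @path_weighted_derive z; first by rewrite !ltW.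
  by rewrite derive1E derive_val; rewrite mulr_ge0_le0.
- by apply: derivable_within_continuous => z; rewrite in_itv/=; exact: E_derivable.
Qed.

Let ends : c 0 = sigma /\ c 1 = w.
Proof.
have l0 : line 0 = sigma by apply/funext => i; rewrite /line; ring.
have l1 : line 1 = w by apply/funext => i; rewrite /line; ring.
have [|m0 e0] := @mP 0; first by rewrite l0.
have [|m1 e1] := @mP 1; first by rewrite l1.
have one (f : 'I_n -> R) : (fun i => 1 * f i) = f by apply/funext => i; rewrite mul1r.
have h0 : m 0 = 1.
  apply: (scale_unique n3 theta_bound sigma0 m0 ltr01); first by rewrite l0 in e0.
  by rewrite one.
have h1 : m 1 = 1.
  apply: (scale_unique n3 theta_bound w0 m1 ltr01); first by rewrite l1 in e1.
  by rewrite one.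
by rewrite /c h0 h1 l0 l1 !one.
Qed.

Lemma path_end : E 1 <= E 0 /\ (E 1 = E 0 -> forall i,
  support_length theta sigma i = support_length theta w i).
Proof.
split; first exact: E_nincr.
move=> e01 i; have [<- <-] := ends.
have Ec z : 0 <= z -> z <= 1 -> E z = E 0.
  by move=> z0 z1; apply/eqP; rewrite eq_le E_nincr//= -e01 E_nincr.
pose l z := support_length theta (c z) i.
(* The factor k is known to be positive only before the endpoint 1; continuity of l takes care of
   the ends. *)
have dl0 z : z \in `]0, 1[ -> is_derive z 1 l 0.
  move=> z01; have := z01; rewrite in_itv/= => /andP[z0 z1].
  have [|u [dl [k [_ k0] dE] _ uu0]] := @path_weighted_derive z; first by rewrite !ltW.
  have E' : k * length_form theta (c z) u u = 0.
    apply: (near_cst_derive _ dE (c := E 0)).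
    have := near_in_itvoo z01; apply: filterS => y; rewrite in_itv/= => /andP[y0 y1].
    by apply: Ec; exact: ltW.
  have uu : length_form theta (c z) u u = 0.
    by apply: (mulfI (lt0r_neq0 (k0 z1))); rewrite E' mulr0.
  by apply: (is_derive_eq (dl i)); exact: uu0.
have cl : {within `[0, 1], continuous l}.
  apply: derivable_within_continuous => z; rewrite in_itv/= => z01.
  by have [u [dl _ _ _]] := @path_weighted_derive z z01; case: (dl i).
have [z _] := MVT (@ltr01 R) dl0 cl.
by rewrite mul0r => /eqP; rewrite subr_eq0 => /eqP.
Qed.

Lemma path_compare :
  \sum_i w i * support_length theta w i <= \sum_i w i * support_length theta sigma i /\
  (\sum_i w i * support_length theta w i = \sum_i w i * support_length theta sigma i ->
   forall i, support_length theta sigma i = support_length theta w i).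
Proof. by have [e0 e1] := ends; have := path_end; rewrite /E e0 e1. Qed.

End Scale.

Lemma weighted_length_min :
  \sum_i w i * support_length theta w i <= \sum_i w i * support_length theta sigma i /\
  (\sum_i w i * support_length theta w i = \sum_i w i * support_length theta sigma i ->
   forall i, support_length theta sigma i = support_length theta w i).
Proof.
have [d d0 hd] := line_margin; have [m hm] := path_scale.
exact: path_compare hd hm d0.
Qed.

End Path.

Lemma mdot_suml (R : realType) (I : Type) (r : seq I) (f : I -> 'rV[R]_3)
    (u : 'rV[R]_3) :
  mdot (\sum_(i <- r) f i) u = \sum_(i <- r) mdot (f i) u.
Proof.
elim: r => [|i r IH]; last by rewrite !big_cons mdotDl IH.
by rewrite !big_nil /mdot !mxE; ring.
Qed.

(** * The centred polygon as the only minimum *)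

Section Assembly.
Variables (R : realType) (n : nat) (theta : 'I_n -> R).
Hypothesis (n3 : (3 <= n)%N) (theta_bound : forall i, 0 < theta i <= pi / 2).
Hypothesis theta_sum : 2 * pi < \sum_(i < n) (pi - theta i).
Implicit Types (P Q : 'I_n -> H2 R) (w : 'I_n -> R).

Let theta0 i : 0 < theta i < pi.
Proof. by have := theta_bound i; have := @pi_gt0 R; lra. Qed.

Let n0 : (0 < n)%N. Proof. exact: leq_trans n3. Qed.

(** The normalised sum of the vertices: its pairing with N i is a sum of nonnegative terms, and the
    term of vertex i+2 is positive. *)
Lemma interior_point P N : inward_normals P N ->
  exists q : H2 R, forall i, 0 < mdot q (N i).
Proof.
move=> PN; pose v := \sum_(j < n) hpt (P j).
have vP x : mdot v (hpt x) < 0.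
  rewrite /v mdot_suml (bigD1 (Ordinal n0))//= ltr_wnDr//.
    by apply: sumr_le0 => j _; have := mdot_H2_le (P j) x; lra.
  by have := mdot_H2_le (P (Ordinal n0)) x; lra.
have vv : mdot v v < 0.
  rewrite {1}/v mdot_suml (bigD1 (Ordinal n0))//= ltr_wnDr//.
    by apply: sumr_le0 => j _; rewrite mdotC ltW.
  by rewrite mdotC.
have [q [k k0 qE]] := H2_scale vv (vP (P (Ordinal n0))).
exists q => i; rewrite qE mdotZl mulr_gt0// /v mdot_suml.
have [_ xN yN pos] := PN i.
rewrite (bigD1 (ordS (ordS i)))//= ltr_pwDl ?pos ?off_edge_SS//.
apply: sumr_ge0 => j _.
have [->|ji] := eqVneq j i; first by rewrite xN.
have [->|jSi] := eqVneq j (ordS i); first by rewrite yN.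
by rewrite ltW// pos// /off_edge ji.
Qed.

Lemma support_data P : polygons_with_angles theta P -> exists s : 'I_n -> R,
  [/\ forall i, 0 < s i, total_angle theta s = 2 * pi &
      forall i, edge_length P i = support_length theta s i].
Proof.
move=> [cP aP]; have [N PN] := convex_inward_normals n3 cP.
have [q q0] := interior_point PN.
exists (fun i => mdot q (N i)); split=> //.
  exact: (total_angle_support n3 theta0 cP aP PN).
exact: (edge_length_support n3 theta0 q cP aP PN).
Qed.

(* C stands for has_inscribed_circle, with w = 1, or has_weighted_center w. *)
Lemma minimizer_center w (C : set ('I_n -> H2 R)) : (forall i, 0 < w i) ->
  (forall P N (q : H2 R) (t : R), convex_polygon P -> (forall i, angle P i = theta i) ->
     inward_normals P N -> 0 < t -> (forall i, mdot q (N i) = t * w i) -> C P) ->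
  (forall P N, convex_polygon P -> (forall i, angle P i = theta i) ->
     inward_normals P N -> C P ->
     exists2 q : H2 R, forall i, 0 < mdot q (N i) &
       exists t : R, forall i, mdot q (N i) = t * w i) ->
  exists P,
    only_up_to_congruence
      (minimizers (weighted_perimeter w) (polygons_with_angles theta)) P /\
    only_up_to_congruence (polygons_with_angles theta `&` C) P.
Proof.
move=> w0 C1 C2.
have [t t0 tw] := exists_scale n3 theta_bound theta_sum w0.
have s0 i : 0 < t * w i by rewrite mulr_gt0.
pose P := std theta n3 (fun i => t * w i).
have Ppoly : polygons_with_angles theta P by exact: std_polygon.
have Pin : inward_normals P (std_normal theta n3 (fun i => t * w i)).
  exact: std_inward.
pose q := origin R.
have qs i : mdot q (std_normal theta n3 (fun i => t * w i) i) = t * w i.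
  exact: mdot_origin_normal.
have Plen i : edge_length P i = support_length theta (fun i => t * w i) i.
  case: (Ppoly) => cP aP.
  rewrite (edge_length_support n3 theta0 q cP aP Pin).
  by congr support_length; apply/funext => j; rewrite qs.
have PC : C P.
  by case: (Ppoly) => cP aP; apply: (C1 P _ q t cP aP Pin t0 qs).
(* In [weighted_length_min] the weights are themselves the target data, so it is applied to t w,
   which multiplies the perimeter by t. *)
have wpE Q (s : 'I_n -> R) : (forall i, edge_length Q i = support_length theta s i) ->
    t * weighted_perimeter w Q = \sum_i (t * w i) * support_length theta s i.
  move=> Ql; rewrite /weighted_perimeter mulr_sumr; apply: eq_bigr => i _.
  by rewrite Ql mulrA.
have cmp Q : polygons_with_angles theta Q ->
    weighted_perimeter w P <= weighted_perimeter w Q /\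
    (weighted_perimeter w P = weighted_perimeter w Q -> congruent P Q).
  move=> Qpoly; have [s [sp stot Ql]] := support_data Qpoly.
  have [h1 h2] := weighted_length_min n3 theta_bound theta_sum sp s0 stot tw.
  rewrite -(wpE P _ Plen) -(wpE Q _ Ql) in h1 h2.
  split; first by rewrite -(ler_pM2l t0).
  move=> e; apply: (congruent_edge_length n3 theta0 Ppoly Qpoly) => i.
  by rewrite Plen Ql h2// e.
exists P; split; split=> //.
- by split=> // Q /cmp[].
- move=> Q [Qpoly Qmin]; have [h1 h2] := cmp Q Qpoly.
  by apply: h2; apply/eqP; rewrite eq_le h1 Qmin.
- move=> Q [Qpoly QC]; case: (Qpoly) => cQ aQ.
  have [N QN] := convex_inward_normals n3 cQ.
  have [q' q'0 [t' q't]] := C2 Q N cQ aQ QN QC.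
  have t'0 : 0 < t'.
    by have := q'0 (Ordinal n0); rewrite q't pmulr_lgt0.
  have q'E : (fun i => mdot q' (N i)) = fun i => t' * w i by apply/funext => i.
  have tot' := total_angle_support n3 theta0 cQ aQ QN q'0.
  rewrite q'E in tot'.
  have tt' := scale_unique n3 theta_bound w0 t0 t'0 tw tot'.
  apply: (congruent_edge_length n3 theta0 Ppoly Qpoly) => i.
  by rewrite Plen (edge_length_support n3 theta0 q' cQ aQ QN) q'E tt'.
Qed.

End Assembly.

Unset Implicit Arguments.

Theorem proposition1p5 (R : realType) (n : nat) (theta : 'I_n -> R)
  (theta_bound : forall i, 0 < theta i <= pi / 2)
  (theta_sum : 2 * pi < \sum_(i < n) (pi - theta i)) :
  (exists P : 'I_n -> H2 R,
     only_up_to_congruence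
       (minimizers (@perimeter R n) (polygons_with_angles theta)) P /\
     only_up_to_congruence
       (polygons_with_angles theta `&` [set Q | has_inscribed_circle Q]) P) /\
  (forall w : 'I_n -> R, (forall i, 0 < w i) ->
   exists P : 'I_n -> H2 R,
     only_up_to_congruence
       (minimizers (weighted_perimeter w) (polygons_with_angles theta)) P /\
     only_up_to_congruence
       (polygons_with_angles theta `&` [set Q | has_weighted_center w Q]) P).
Proof.
have pi0 := @pi_gt0 R.
(* Each exterior angle is below pi, so a sum above 2 pi takes more than two of them. *)
have n3 : (3 <= n)%N.
  have : 2 * pi < n%:R * (pi : R).
    apply: lt_le_trans theta_sum _.
    rewrite mulr_natl -[X in _ *+ X]card_ord -sumr_const.
    by apply: ler_sum => i _; have := theta_bound i; lra.
  by rewrite ltr_pM2r// (ltr_nat _ 2).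
split.
- apply: (minimizer_center n3 theta_bound theta_sum (fun=> ltr01)).
  + move=> P N q t cP aP PN t0 qt.
    have qt1 i : mdot q (N i) = t by rewrite qt mulr1.
    have q0 i : 0 < mdot q (N i) by rewrite qt1.
    exact: (inscribed_circle_support n3 theta_bound cP aP PN q0 qt1).
  + move=> P N cP aP PN cir.
    have [q q0 [t qt]] := inscribed_circle_ratio n3 cP PN cir.
    by exists q => //; exists t => i; rewrite mulr1.
- move=> w w0; apply: (minimizer_center n3 theta_bound theta_sum w0).
  + move=> P N q t cP aP PN t0 qt.
    have q0 i : 0 < mdot q (N i) by rewrite qt mulr_gt0.
    exact: (weighted_center_support n3 theta_bound cP aP PN q0 w0 qt).
  + by move=> P N cP aP PN; exact: (weighted_center_ratio n3 theta_bound cP aP PN w0).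
Qed.
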